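(* Let $X$ be the subshift of a primitive and compatible random substitution. There exists a sequence $(\mu_n)_n$ of frequency measures on $X$ (each $\mu_n$ being the frequency measure of a primitive random substitution whose subshift is $X$) such that $\mu_n$ converges weakly to a measure of maximal entropy $\mu$ for the system $(X,S)$, that is, to a shift-invariant Borel probability measure $\mu$ on $X$ with $h(\mu)=h_{\mathrm{top}}(X)$.
   Context: $\mathbb{N}=\{1,2,\dots\}$. $\mathcal{A}=\{a_1,\dots,a_d\}$ is a finite alphabet, $\mathcal{A}^+$ the set of non-empty finite words, $|u|$ the length of a word $u$, and $|u|_v$ the number of (possibly overlapping) occurrences of $v$ as a subword of $u$. A random substitution $\vartheta_{\mathbf{P}}=(\vartheta,\mathbf{P})$ is a map $\vartheta$ assigning to each letter $a_i$ a non-empty finite set $\vartheta(a_i)=\{s^{(i,1)},\dots,s^{(i,r_i)}\}\subset\mathcal{A}^+$ of $r_i$ distinct words, together with probability vectors $\mathbf{p}_i=(p_{i,1},\dots,p_{i,r_i})$ with all $p_{i,j}>0$; $\vartheta_{\mathbf{P}}(a_i)$ is the random word equal to $s^{(i,j)}$ with probability $p_{i,j}$. It is extended to words by applying it independently to each letter and concatenating; $(\vartheta_{\mathbf{P}}^n(u))_{n}$ is the Markov chain obtained by iterating this with fresh independent choices at each step, starting from $u$. $\mathbb{P},\mathbb{E}$ denote the corresponding probability and expectation, and $\vartheta^n(u)=\{v:\mathbb{P}[\vartheta_{\mathbf{P}}^n(u)=v]>0\}$. The substitution matrix is $M_{i,j}=\mathbb{E}[|\vartheta_{\mathbf{P}}(a_j)|_{a_i}]$.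 $\vartheta_{\mathbf{P}}$ is primitive if $M$ is primitive and its Perron--Frobenius eigenvalue satisfies $\lambda>1$. It is compatible if for all $a\in\mathcal{A}$, $u,v\in\vartheta(a)$ and $b\in\mathcal{A}$, $|u|_b=|v|_b$. The language $\mathcal{L}_\vartheta$ is the set of words occurring as subwords of some word in $\vartheta^k(a)$, $a\in\mathcal{A}$, $k\in\mathbb{N}$; the subshift $X_\vartheta\subset\mathcal{A}^{\mathbb{Z}}$ of $\vartheta_{\mathbf{P}}$ is the set of bi-infinite sequences all of whose finite subwords lie in $\mathcal{L}_\vartheta$, with left shift $S$. For $v\in\mathcal{L}_\vartheta$, $[v]=\{x\in X_\vartheta: x_0\cdots x_{|v|-1}=v\}$. For primitive $\vartheta_{\mathbf{P}}$, the frequency measure $\mu_{\mathbf{P}}$ is the unique shift-invariant Borel probability measure on $X_\vartheta$ with $\mu_{\mathbf{P}}([v])=\lim_{k\to\infty}\mathbb{E}[|\vartheta_{\mathbf{P}}^k(a)|_v]/\mathbb{E}[|\vartheta_{\mathbf{P}}^k(a)|]$ for all $v\in\mathcal{L}_\vartheta$ (the limit exists and is independent of $a$; $\mu_{\mathbf{P}}$ is ergodic). For a subshift $X$, $\mathcal{L}^n(X)$ is the set of words of length $n$ occurring in elements of $X$, $h_{\mathrm{top}}(X)=\lim_n\frac1n\log\#\mathcal{L}^n(X)$, and for a shift-invariant Borel probability measure $\nu$ on $X$, $h(\nu)=\lim_n\frac1n\sum_{u\in\mathcal{L}^n(X)}-\nu([u])\log\nu([u])$ (with $0\log 0=0$).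 *)

(* Defs.v *)
From HB Require Import structures.
From mathcomp Require Import all_boot all_order all_algebra finmap complex.
From mathcomp Require Import all_classical all_reals all_analysis.

Set Implicit Arguments.
Unset Strict Implicit.
Unset Printing Implicit Defensive.

Import Order.TTheory GRing.Theory Num.Theory.
Import numFieldNormedType.Exports.

Local Open Scope classical_set_scope.
Local Open Scope ring_scope.

(** The alphabet is {0, ..., d}, hence nonempty. *)
Notation letter d := 'I_d.+1.
Notation word d := (seq (letter d)).

(** Measurable types are required to be pointed in the library. *)
HB.instance Definition _ (d : nat) := isPointed.Build (letter d) ord0.

(** Number of (possibly overlapping) occurrences of [v] in [u], counted by
    starting position. *)
Definition occ (d : nat) (v u : word d) : nat :=
  count (fun i => prefix v (drop i u)) (iota 0 (size u)).

(** [images a] is the finite set of possible images of [a], and [weight a s] the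
    probability of the image [s]; the values of [weight a] outside [images a]
    are never used. *)
Record random_subst (R : realType) (d : nat) := RandomSubst {
  images : letter d -> {fset word d};
  weight : letter d -> word d -> R;
  images_neq0 : forall a, images a != fset0;
  images_nonnil : forall a s, s \in images a -> s != [::];
  weight_gt0 : forall a s, s \in images a -> 0 < weight a s;
  weight_sum1 : forall a, \sum_(s <- images a) weight a s = 1
}.

(** The law of a random word with finitely many values, as a list of
    (probability, outcome) pairs; an outcome may be listed more than once, and
    its probability is then the sum of the listed ones. *)
Definition law (R : realType) (d : nat) : Type := seq (R * word d).

Definition Pr (R : realType) (d : nat) (L : law R d) (v : word d) : R :=
  \sum_(x <- L | x.2 == v) x.1.

Definition Ex (R : realType) (d : nat) (L : law R d) (f : word d -> R) : R :=
  \sum_(x <- L) x.1 * f x.2.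

Section RandomSubstitution.
Context {R : realType} {d : nat}.
Implicit Types (theta : random_subst R d) (a : letter d) (u v : word d).

Definition letter_law theta a : law R d :=
  [seq (weight theta a s, s) | s <- images theta a].

(** Concatenation of independent images of the letters. *)
Fixpoint word_law theta u : law R d :=
  if u is a :: u' then
    [seq (x.1 * y.1, x.2 ++ y.2) | x <- letter_law theta a,
                                   y <- word_law theta u']
  else [:: (1, [::])].

(** Law at time [n] of the Markov chain started at [u]. *)
Fixpoint iter_law theta (n : nat) u : law R d :=
  if n is m.+1 then
    [seq (x.1 * y.1, y.2) | x <- iter_law theta m u, y <- word_law theta x.2]
  else [:: (1, u)].

Definition subst_mx theta : 'M[R]_d.+1 :=
  \matrix_(i, j) Ex (letter_law theta j) (fun w => (occ [:: i] w)%:R).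

Definition primitive_mx (M : 'M[R]_d.+1) : Prop :=
  exists2 k : nat, (0 < k)%N & forall i j, 0 < (M ^+ k) i j.

(** The Perron-Frobenius eigenvalue: the real eigenvalue that dominates all
    complex eigenvalues in modulus. *)
Definition is_PF_eigenvalue (M : 'M[R]_d.+1) (lambda : R) : Prop :=
  eigenvalue M lambda /\
  forall z : R[i], eigenvalue (map_mx (real_complex R) M) z ->
    `|z| <= real_complex R lambda.

Definition primitive_subst theta : Prop :=
  primitive_mx (subst_mx theta) /\
  exists2 lambda : R, is_PF_eigenvalue (subst_mx theta) lambda & 1 < lambda.

Definition compatible theta : Prop :=
  forall a u v, u \in images theta a -> v \in images theta a ->
  forall b, occ [:: b] u = occ [:: b] v.

Definition language theta : set (word d) :=
  [set v | exists a k w,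
    [/\ (0 < k)%N, 0 < Pr (iter_law theta k [:: a]) w & infix v w]].

End RandomSubstitution.

(** Bi-infinite sequences, with the product of the discrete topologies and the
    corresponding Borel sigma-algebra. *)
Definition fullshift (d : nat) : Type := int -> letter d.
HB.instance Definition _ (d : nat) := Pointed.copy (fullshift d)
  (prod_topology (fun _ : int => discrete_topology (letter d))).
HB.instance Definition _ (d : nat) := Topological.copy (fullshift d)
  (prod_topology (fun _ : int => discrete_topology (letter d))).
HB.instance Definition _ (d : nat) := Measurable.copy (fullshift d)
  (g_sigma_algebraType (@open (fullshift d))).

Definition shift (d : nat) (x : fullshift d) : fullshift d :=
  fun i => x (i + 1).

(** The subword x_i ... x_(i+n-1). *)
Definition subword (d : nat) (x : fullshift d) (i : int) (n : nat) : word d :=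
  mkseq (fun k => x (i + k%:Z)) n.

Definition subshift (R : realType) (d : nat) (theta : random_subst R d) :
    set (fullshift d) :=
  [set x | forall i n, language theta (subword x i n)].

Definition cylinder (d : nat) (X : set (fullshift d)) (v : word d) :
    set (fullshift d) :=
  [set x | X x /\ subword x 0 (size v) = v].

(** A Borel probability measure on the subshift [X] is represented by a Borel
    probability measure on the full shift giving [X] full measure. *)
Definition invariant_measure (R : realType) (d : nat) (X : set (fullshift d))
    (mu : probability (fullshift d) R) : Prop :=
  mu X = 1%E /\
  forall B, measurable B -> mu (@shift d @^-1` B) = mu B.

Definition frequency_measure (R : realType) (d : nat)
    (theta : random_subst R d) (mu : probability (fullshift d) R) : Prop :=
  invariant_measure (subshift theta) mu /\
  forall v, language theta v -> forall a,
    Ex (iter_law theta k [:: a]) (fun w => (occ v w)%:R) /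
    Ex (iter_law theta k [:: a]) (fun w => (size w)%:R)
      @[k --> \oo] --> fine (mu (cylinder (subshift theta) v)).

Definition lang_n (d : nat) (X : set (fullshift d)) (n : nat) :
    {set n.-tuple (letter d)} :=
  [set u : n.-tuple (letter d) |
    `[< exists x i, X x /\ subword x i n = u :> seq _ >]]%SET.

Definition htop (R : realType) (d : nat) (X : set (fullshift d)) : R :=
  lim ((n%:R^-1 * ln (#|lang_n X n|%:R : R)) @[n --> \oo]).

Definition entropy (R : realType) (d : nat) (X : set (fullshift d))
    (nu : probability (fullshift d) R) : R :=
  lim ((n%:R^-1 * \sum_(u in lang_n X n)
      - (fine (nu (cylinder X u)) * ln (fine (nu (cylinder X u)))))
    @[n --> \oo]).

Definition measure_of_maximal_entropy (R : realType) (d : nat)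
    (X : set (fullshift d)) (mu : probability (fullshift d) R) : Prop :=
  invariant_measure X mu /\ entropy X mu = htop R X.

(** Weak convergence of probability measures on [X]; the test functions are the
    functions that are continuous on the subspace [X]. *)
Definition weakly_converges (R : realType) (d : nat) (X : set (fullshift d))
    (mu_ : nat -> probability (fullshift d) R)
    (mu : probability (fullshift d) R) : Prop :=
  forall f : fullshift d -> R, {within X, continuous f} ->
    (\int[mu_ n]_(x in X) (f x)%:E)%E @[n --> \oo]
      --> (\int[mu]_(x in X) (f x)%:E)%E.

(* Main.v *)
From Pilot Require Import Defs.
From HB Require Import structures.
From mathcomp Require Import all_boot all_order all_algebra finmap complex.
From mathcomp Require Import all_classical all_reals all_analysis.
From mathcomp Require Import measurable_realfun.
From mathcomp Require Import zify ring lra.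

Set Implicit Arguments.
Unset Strict Implicit.
Unset Printing Implicit Defensive.

Import Order.TTheory GRing.Theory Num.Theory.
Import numFieldNormedType.Exports.

Local Open Scope classical_set_scope.
Local Open Scope ring_scope.

(** Compatibility makes all [k]-th images of a letter [a] equally long, with
    the same number of each letter; let [len k a] be their length. Some power
    of the substitution is [full]: every image contains all letters and has at
    least two. Powers change neither the subshift ([subshift_power]) nor
    primitivity ([primitive_power]), so the substitution may be assumed to be
    full.

    The numbers [ln (num_images (power theta k) a) / (len theta k a)] have a
    limit [h] that does not depend on [a]. Indeed, the images of the letters of
    a word are chosen freely and their concatenation determines them, so that
    the numbers at time [k + 1] are, up to an error of order [2 ^ - k],
    averages of those at time [k], with weights that are bounded away from 0.
    Such averaging contracts the oscillation ([averaging_cvg]). The same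
    contraction gives the existence of word frequencies, without
    Perron-Frobenius theory ([frequency_exists]).

    On the one hand, a word of length [N] of the language is found inside a
    [k]-th image of a word whose length is about [N] divided by the length of
    the [k]-th images of letters. Counting these gives the upper bound [h] for
    the topological entropy ([complexity_rate]).

    On the other hand, let [m] be the frequencies of the [k]-th power of
    [theta], all images of a letter having the same probability. Given its
    predecessor, an image at time [n + 1] is uniformly distributed on a set of
    known cardinality. By Gibbs' inequality, the mean of [- ln Q] is then at
    least [h_k] times the length of the images, for every sub-probability [Q]
    on the words of that length, where [h_k] is the smallest of the above
    numbers at time [k]. For [Q] the Markov measure with memory [N] whose
    transition probabilities are the conditional frequencies, this mean is
    about the length times [H_(N+1) - H_N], with [H_N] the entropy of the
    blocks of length [N]. Hence [H_N >= N * h_k] for every [N]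
    ([block_entropy_ge]).

    Along a subsequence the frequencies of the powers converge on all words
    ([diagonal_subsequence]). For fixed [N] the lower bound passes to the
    limit, whose block entropies thus satisfy [N * h <= H_N <= ln |L_N|], with
    [L_N] the set of the words of length [N]. With the upper bound on the
    complexity, the limit has entropy [h], which is also the topological
    entropy. Shift-invariant families of word weights are realized by measures
    through a coding of the unit interval ([weight_measure_exists],
    [block_weight]), and since the subshift is compact, convergence on
    cylinders is weak convergence ([weak_cvg]). *)

(** * Occurrences of a word *)

Section Occurrences.
Context {d : nat}.
Implicit Types (a b : letter d) (u v w : word d).

Lemma occ_cons v a u : occ v (a :: u) = (prefix v (a :: u) + occ v u)%N.
Proof.
rewrite /occ /=; congr (_ + _)%N.
by rewrite -[1%N]/(1 + 0)%N iotaDl count_map.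
Qed.

Lemma occ_cat_ge v u w : (occ v u + occ v w <= occ v (u ++ w))%N.
Proof.
elim: u => [|a u IH] //; rewrite cat_cons !occ_cons -addnA leq_add //.
case: (boolP (prefix v (a :: u))) => // /prefixP[s E].
by rewrite -cat_cons E -catA prefix_prefix.
Qed.

(** An occurrence that starts in [u] but does not fit into it starts at one of
    the last [size v] positions of [u]. *)
Lemma occ_cat_le v u w :
  (occ v (u ++ w) <= occ v u + occ v w + size v)%N.
Proof.
suff: (occ v (u ++ w) <= occ v u + occ v w + minn (size u) (size v))%N by lia.
elim: u => [|a u IH]; first by rewrite min0n addn0.
rewrite cat_cons !occ_cons [size (a :: u)]/=.
have [vu|uv] := leqP (size v) (size u).+1; last first.
  have : (prefix v (a :: u ++ w) <= 1)%N by case: prefix.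
  by lia.
have -> : prefix v (a :: u ++ w) = prefix v (a :: u); last by lia.
rewrite !prefixE -cat_cons take_cat /=.
case: ltngtP vu => // -> _.
by rewrite subnn take0 cats0 (take_size (a :: u)).
Qed.

Lemma occ1 a u : occ [:: a] u = count_mem a u.
Proof.
by elim: u => //= b u IH; rewrite occ_cons /= IH prefix0s andbT eq_sym.
Qed.

Lemma occ_nil u : occ [::] u = size u.
Proof. by elim: u => //= b u IH; rewrite occ_cons IH. Qed.

Lemma occ_gt0_infix v u : (0 < occ v u)%N -> infix v u.
Proof.
elim: u => // a u IH; rewrite occ_cons addn_gt0 lt0b =>
  /orP[/prefixW //|/IH iv].
exact: infix_trans iv (infix_cons _ _).
Qed.

Lemma infix_occ_gt0 v u : (0 < size u)%N -> infix v u -> (0 < occ v u)%N.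
Proof.
elim: u => // a u IH _; rewrite occ_cons infix_consl => /orP[->//|].
case: u IH => [_|b u IH iv]; last by rewrite addn_gt0 IH ?orbT.
by rewrite infixs0 => /eqP ->.
Qed.

(** Every occurrence of [v] starts an occurrence of some [rcons v a], except
    one at the very end of the word. *)
Lemma sum_occ_rcons v u :
  (\sum_a occ (rcons v a) u <= occ v u <= \sum_a occ (rcons v a) u + 1)%N.
Proof.
have P z : prefix v z = (\sum_a prefix (rcons v a) z + (v == z))%N :> nat.
  have rE a : prefix (rcons v a) z = prefix v z && (drop (size v) z != [::]) &&
        (a == head a (drop (size v) z)).
    case: (boolP (prefix v z)) => [/prefixP[s ->]|].
      rewrite -cats1 prefix_catr // eqxx andTb drop_size_cat //.
      by case: s => //= y s; rewrite prefix0s andbT.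
    by apply: contraNF => /(prefix_trans (prefix_rcons _ _)).
  under eq_bigr do rewrite rE.
  case: (boolP (prefix v z)) => /= [/prefixP[s ->]|nv]; last first.
    rewrite big1 // add0n; case: eqP nv => // ->.
    by rewrite prefix_refl.
  rewrite drop_size_cat //; case: s => /= [|y s].
    by rewrite cats0 eqxx big1.
  rewrite (bigD1 y) //= eqxx big1 => [|i /negbTE -> //].
  by rewrite -{1}(cats0 v) eqseq_cat // eqxx.
have S x y : (\sum_a occ (rcons v a) (x :: y) =
    \sum_a prefix (rcons v a) (x :: y) + \sum_a occ (rcons v a) y)%N.
  by under eq_bigr do rewrite occ_cons; rewrite big_split.
apply/andP; split.
  elim: u => [|x u IH]; first by rewrite big1.
  by rewrite occ_cons S P; lia.
suff: (occ v u <= \sum_a occ (rcons v a) u + (size v <= size u))%N.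
  by case: leqP; lia.
elim: u => [|x u IH]; first by rewrite big1.
rewrite occ_cons S P [size (x :: u)]/=.
case: eqP => [vE|_]; last by move: IH; do 2 case: leqP; lia.
have -> : occ v u = 0%N.
  apply/eqP; rewrite -leqn0 leqNgt; apply/negP => /occ_gt0_infix /size_infix.
  by rewrite vE /= ltnn.
by rewrite vE /= leqnn; lia.
Qed.

(** Every occurrence of [v] is preceded by a letter, except one at the very
    beginning of the word; the empty word is counted at positions [0] to [size
    u - 1] only. *)
Lemma sum_occ_cons v u :
  (\sum_a occ (a :: v) u + prefix v u = occ v u + (v == [::]))%N.
Proof.
elim: u => [|x u IH].
  by rewrite big1 // prefixs0.
have -> : (\sum_a occ (a :: v) (x :: u) =
    prefix v u + \sum_a occ (a :: v) u)%N.
  under eq_bigr do rewrite occ_cons.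
  rewrite big_split; congr (_ + _)%N.
  by rewrite (bigD1 x) //= eqxx big1 ?addn0 // => i /negbTE ->.
by rewrite occ_cons; lia.
Qed.

End Occurrences.

(** * Finitely supported laws of random words *)

Section Laws.
Context {R : realType} {d : nat}.
Implicit Types (L : law R d) (theta : random_subst R d) (a b : letter d).
Implicit Types (u v w y z : word d) (f g : word d -> R).

Definition outcomes L : seq (word d) := [seq x.2 | x <- L].

Definition positive_law L := {in L, forall x, 0 < x.1}.

Lemma Ex_bind L (K : word d -> law R d) f :
  Ex (allpairs_dep (fun x y : R * word d => (x.1 * y.1, y.2)) L
    (fun x => K x.2)) f =
  Ex L (fun w => Ex (K w) f).
Proof.
rewrite /Ex big_allpairs_dep /=; apply: eq_bigr => x _.
by rewrite mulr_sumr; apply: eq_bigr => y _; rewrite mulrA.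
Qed.

Lemma eq_Ex L f g : {in outcomes L, f =1 g} -> Ex L f = Ex L g.
Proof.
move=> fg; rewrite /Ex !big_seq; apply: eq_bigr => x xL; rewrite fg //.
exact: map_f.
Qed.

Lemma ExD L f g : Ex L (fun w => f w + g w) = Ex L f + Ex L g.
Proof. by rewrite /Ex -big_split; apply: eq_bigr => x _; rewrite mulrDr. Qed.

Lemma ExZ L c f : Ex L (fun w => c * f w) = c * Ex L f.
Proof. by rewrite /Ex mulr_sumr; apply: eq_bigr => x _; rewrite mulrCA. Qed.

Lemma Ex_sum L (I : finType) (F : I -> word d -> R) :
  Ex L (fun w => \sum_i F i w) = \sum_i Ex L (F i).
Proof.
rewrite /Ex exchange_big; apply: eq_bigr => x _.
by rewrite mulr_sumr.
Qed.

Lemma Ex_cst L c : Ex L (fun=> c) = c * Ex L (fun=> 1).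
Proof. by rewrite -ExZ; apply: eq_Ex => w _ /=; rewrite mulr1. Qed.

Lemma le_Ex L f g : positive_law L -> {in outcomes L, forall w, f w <= g w} ->
  Ex L f <= Ex L g.
Proof.
move=> L0 fg; rewrite /Ex !big_seq; apply: ler_sum => x xL.
by apply: ler_wpM2l; [exact/ltW/L0 | apply: fg; exact: map_f].
Qed.

Lemma Ex_exchange L1 L2 (F : word d -> word d -> R) :
  Ex L1 (fun w => Ex L2 (F w)) = Ex L2 (fun z => Ex L1 (F^~ z)).
Proof.
rewrite /Ex.
under eq_bigr do rewrite mulr_sumr.
rewrite exchange_big; apply: eq_bigr => x _ /=.
by rewrite mulr_sumr; apply: eq_bigr => y _; rewrite mulrCA.
Qed.

Lemma Pr_gt0 L v : positive_law L -> (0 < Pr L v) <-> v \in outcomes L.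
Proof.
move=> L0; rewrite /Pr; split=> [|/mapP[x xL ->]].
  apply: contraTT => vL; rewrite big_seq_cond big1 ?ltxx // =>
    x /andP[xL /eqP xv].
  by case/negP: vL; rewrite -xv map_f.
rewrite big_seq_cond (big_rem x) //= xL eqxx /= ltr_wpDr ?L0 //.
by apply: sumr_ge0 => y /andP[/L0/ltW].
Qed.

Lemma Ex_word_nil theta f : Ex (word_law theta [::]) f = f [::].
Proof. by rewrite /Ex big_seq1 mul1r. Qed.

Lemma Ex_letter theta a f :
  Ex (letter_law theta a) f = \sum_(s <- images theta a) weight theta a s * f s.
Proof. by rewrite /Ex big_map. Qed.

Lemma Ex_word_cons theta a u f : Ex (word_law theta (a :: u)) f =
  Ex (letter_law theta a) (fun s => Ex (word_law theta u) (fun y =>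
    f (s ++ y))).
Proof.
rewrite /Ex big_allpairs_dep /= big_map big_map; apply: eq_bigr => x _ /=.
by rewrite mulr_sumr; apply: eq_bigr => y _; rewrite mulrA.
Qed.

Lemma Ex_word1 theta a f :
  Ex (word_law theta [:: a]) f = Ex (letter_law theta a) f.
Proof.
rewrite Ex_word_cons; apply: eq_Ex => s _.
by rewrite Ex_word_nil cats0.
Qed.

Lemma Ex_word_cat theta u v f : Ex (word_law theta (u ++ v)) f =
  Ex (word_law theta u) (fun y => Ex (word_law theta v) (fun z => f (y ++ z))).
Proof.
elim: u f => [|a u IH] f; first by rewrite Ex_word_nil.
rewrite cat_cons !Ex_word_cons; apply: eq_Ex => s _; rewrite IH.
by apply: eq_Ex => y _; apply: eq_Ex => z _; rewrite catA.
Qed.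

Lemma Ex_iter0 theta u f : Ex (iter_law theta 0 u) f = f u.
Proof. by rewrite /Ex big_seq1 mul1r. Qed.

Lemma Ex_iterS theta k u f : Ex (iter_law theta k.+1 u) f =
  Ex (iter_law theta k u) (fun w => Ex (word_law theta w) f).
Proof. exact: Ex_bind. Qed.

(** The Markov chain may be split after its first step as well as before its
    last one. *)
Lemma Ex_iterSl theta k u f : Ex (iter_law theta k.+1 u) f =
  Ex (word_law theta u) (fun w => Ex (iter_law theta k w) f).
Proof.
elim: k f => [|k IH] f.
  by rewrite Ex_iterS Ex_iter0; apply: eq_Ex => w _; rewrite Ex_iter0.
rewrite Ex_iterS IH; apply: eq_Ex => w _.
by rewrite Ex_iterS.
Qed.

(** Iterating a random substitution on a concatenation amounts to iterating it
    independently on the factors. *)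
Lemma Ex_iter_cat theta k u v f : Ex (iter_law theta k (u ++ v)) f =
  Ex (iter_law theta k u)
    (fun y => Ex (iter_law theta k v) (fun z => f (y ++ z))).
Proof.
elim: k f => [|k IH] f; first by rewrite !Ex_iter0.
rewrite !Ex_iterS IH; apply: eq_Ex => y _.
under [RHS]eq_Ex do rewrite Ex_iterS.
rewrite [RHS]Ex_exchange; apply: eq_Ex => z _.
exact: Ex_word_cat.
Qed.

Lemma Ex_letter1 theta a : Ex (letter_law theta a) (fun=> 1) = 1.
Proof.
rewrite Ex_letter -[RHS](weight_sum1 theta a).
by apply: eq_bigr => s _; rewrite mulr1.
Qed.

Lemma Ex_word_one theta u : Ex (word_law theta u) (fun=> 1) = 1.
Proof.
elim: u => [|a u IH]; first by rewrite Ex_word_nil.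
rewrite Ex_word_cons -[RHS](Ex_letter1 theta a).
by apply: eq_Ex => s _; rewrite IH.
Qed.

Lemma Ex_iter_one theta k u : Ex (iter_law theta k u) (fun=> 1) = 1.
Proof.
elim: k => [|k IH]; first by rewrite Ex_iter0.
rewrite Ex_iterS -[RHS]IH; apply: eq_Ex => w _; exact: Ex_word_one.
Qed.

Lemma Ex_iter_cst theta k u (c : R) : Ex (iter_law theta k u) (fun=> c) = c.
Proof. by rewrite Ex_cst Ex_iter_one mulr1. Qed.

Lemma positive_letter theta a : positive_law (letter_law theta a).
Proof. by move=> _ /mapP[s sI ->]; apply: weight_gt0. Qed.

Lemma positive_word theta u : positive_law (word_law theta u).
Proof.
elim: u => [|a u IH] x; first by rewrite inE => /eqP ->.
move=> /allpairsP[[y z] [/positive_letter y0 /IH z0 ->]] /=.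
exact: mulr_gt0.
Qed.

Lemma positive_iter theta k u : positive_law (iter_law theta k u).
Proof.
elim: k => [|k IH] x; first by rewrite inE => /eqP ->.
move=> /allpairsPdep[y [z [/IH y0 /positive_word z0 ->]]] /=.
exact: mulr_gt0.
Qed.

End Laws.

(** * Supports *)

Section Supports.
Context {R : realType} {d : nat}.
Implicit Types (theta : random_subst R d) (a b : letter d).
Implicit Types (u v w y z : word d).

(** The possible values of the first and of the [k]-th random image of [u]. *)
Definition image_of theta u w := w \in outcomes (word_law theta u).
Definition iter_image theta k u w := w \in outcomes (iter_law theta k u).

Lemma image_of_nil theta w : image_of theta [::] w <-> w = [::].
Proof. by rewrite /image_of inE; split=> [/eqP|->]. Qed.

Lemma image_of_cons theta a u w : image_of theta (a :: u) w <->
  exists s y, [/\ s \in images theta a, image_of theta u y & w = s ++ y].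
Proof.
split=> [/mapP[x] | [s [y [sa /mapP[x xu ->] ->]]]].
  case/allpairsP=> -[p q] /= [/mapP[s sa ->] qu ->] ->.
  by exists s, q.2; split => //; exact: map_f.
apply/mapP; exists (weight theta a s * x.1, s ++ x.2) => //.
apply/allpairsP; exists ((weight theta a s, s), x); split=> //=.
exact: map_f.
Qed.

Lemma image_of1 theta a w : image_of theta [:: a] w <-> w \in images theta a.
Proof.
rewrite image_of_cons; split=> [[s [y [sa /image_of_nil -> ->]]]|wa];
  first by rewrite cats0.
by exists w, [::]; split; rewrite ?cats0 //; apply/image_of_nil.
Qed.

Lemma image_of_cat theta u v w : image_of theta (u ++ v) w <->
  exists y z, [/\ image_of theta u y, image_of theta v z & w = y ++ z].
Proof.
elim: u w => [|a u IH] w /=.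
  split=> [h|[y [z [/image_of_nil -> h ->]]] //].
  by exists [::], w; split=> //; apply/image_of_nil.
rewrite image_of_cons; split=> [[s [x [sa /IH[y [z [uy vz ->]]] ->]]]|].
  exists (s ++ y), z; split=> //; last by rewrite catA.
  by apply/image_of_cons; exists s, y.
move=> [y [z [/image_of_cons[s [x [sa ux ->]]] vz ->]]].
exists s, (x ++ z); rewrite catA; split=> //.
by apply/IH; exists x, z.
Qed.

Lemma iter_image0 theta u w : iter_image theta 0 u w <-> w = u.
Proof. by rewrite /iter_image inE; split=> [/eqP|->]. Qed.

Lemma iter_imageS theta k u w : iter_image theta k.+1 u w <->
  exists2 z, iter_image theta k u z & image_of theta z w.
Proof.
split=> [/mapP[x] | [z /mapP[x xu ->] /mapP[y yz ->]]].
  case/allpairsPdep=> p [q [pu qp ->]] ->.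
  by exists p.2; [exact: (map_f snd pu) | exact: (map_f snd qp)].
apply/mapP; exists (x.1 * y.1, y.2) => //.
by apply/allpairsPdep; exists x, y.
Qed.

Lemma iter_image1 theta u w : iter_image theta 1 u w <-> image_of theta u w.
Proof.
rewrite iter_imageS; split=> [[z /iter_image0 -> //]|h].
by exists u => //; apply/iter_image0.
Qed.

Lemma iter_image_add theta k l u w : iter_image theta (k + l) u w <->
  exists2 z, iter_image theta k u z & iter_image theta l z w.
Proof.
elim: l w => [|l IH] w.
  rewrite addn0; split=> [h|[z h /iter_image0 ->] //].
  by exists w => //; apply/iter_image0.
rewrite addnS iter_imageS.
split=> [[y /IH[z uz zy] yw]|[z uz /iter_imageS[y zy yw]]].
  by exists z => //; apply/iter_imageS; exists y.
by exists y => //; apply/IH; exists z.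
Qed.

Lemma iter_image_cat theta k u v w : iter_image theta k (u ++ v) w <->
  exists y z, [/\ iter_image theta k u y, iter_image theta k v z & w = y ++ z].
Proof.
elim: k w => [|k IH] w.
  rewrite iter_image0; split=> [->|[y [z [/iter_image0 -> /iter_image0 ->
    ->]]] //].
  by exists u, v; split => //; apply/iter_image0.
rewrite iter_imageS; split=> [[x /IH[y [z [uy vz ->]]] /image_of_cat[y' [z'
  [yy' zz' ->]]]]|].
  by exists y', z'; split => //; apply/iter_imageS; [exists y | exists z].
move=> [y' [z' [/iter_imageS[y uy yy'] /iter_imageS[z vz zz'] ->]]].
exists (y ++ z); first by apply/IH; exists y, z.
by apply/image_of_cat; exists y', z'.
Qed.

Lemma iter_image_nil theta k w : iter_image theta k [::] w <-> w = [::].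
Proof.
elim: k w => [|k IH] w; first by rewrite iter_image0.
rewrite iter_imageS; split=> [[z /IH -> /image_of_nil] //|->].
by exists [::]; [apply/IH | apply/image_of_nil].
Qed.

Lemma image_of_ex theta u : exists w, image_of theta u w.
Proof.
elim: u => [|a u [w uw]]; first by exists [::]; apply/image_of_nil.
have /fset0Pn[s sa] := images_neq0 theta a.
by exists (s ++ w); apply/image_of_cons; exists s, w.
Qed.

Lemma iter_image_ex theta k u : exists w, iter_image theta k u w.
Proof.
elim: k => [|k [w uw]]; first by exists u; apply/iter_image0.
by have [z wz] := image_of_ex theta w; exists z; apply/iter_imageS; exists w.
Qed.

Lemma image_of_size theta u w : image_of theta u w -> (size u <= size w)%N.
Proof.
elim: u w => [|a u IH] w; first by [].
case/image_of_cons=> s [y [/images_nonnil s0 /IH uy ->]].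
by rewrite size_cat /=; case: s s0 => //= b s _; lia.
Qed.

Lemma iter_image_size theta k u w : iter_image theta k u w ->
  (size u <= size w)%N.
Proof.
elim: k w => [|k IH] w; first by move=> /iter_image0 ->.
by case/iter_imageS=> z /IH h /image_of_size; apply: leq_trans.
Qed.

(** All listed probabilities being positive, only the supports matter. *)
Lemma languageP theta v : language theta v <->
  exists a k w, [/\ (0 < k)%N, iter_image theta k [:: a] w & infix v w].
Proof.
split=> -[a [k [w [k0 aw vw]]]]; exists a, k, w; split=> //;
  by apply/Pr_gt0 => //; exact: positive_iter.
Qed.

(** A letter of [u] may be developed independently of the rest of [u]. *)
Lemma iter_image_mem theta k u a y : a \in u -> iter_image theta k [:: a] y ->
  exists2 w, iter_image theta k u w & infix y w.
Proof.
case/splitPr=> p q ay.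
have [x px] := iter_image_ex theta k p; have [z qz] := iter_image_ex theta k q.
exists (x ++ (y ++ z)); last exact: infix_infix.
apply/iter_image_cat; exists x, (y ++ z); split=> //.
by rewrite -cat1s; apply/iter_image_cat; exists y, z.
Qed.

Lemma iter_image_mem_inv theta k u w a : iter_image theta k u w -> a \in u ->
  exists2 y, iter_image theta k [:: a] y & infix y w.
Proof.
move=> uw au; case/splitPr: au uw => p q.
case/iter_image_cat=> x [w' [px]]; rewrite -cat1s =>
  /iter_image_cat[y [z [ay qz ->]]] ->.
by exists y => //; exact: infix_infix.
Qed.

End Supports.

(** * Compatible substitutions *)

Section Compatible.
Context {R : realType} {d : nat}.
Implicit Types (theta : random_subst R d) (a b c : letter d).
Implicit Types (u v w y z s : word d).

Lemma sum_letters (V : nmodType) (F : letter d -> V) u :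
  \sum_(a <- u) F a = \sum_b F b *+ count_mem b u.
Proof.
elim: u => [|a u IH]; first by rewrite big_nil big1.
rewrite big_cons IH; under [RHS]eq_bigr do rewrite /= mulrnDr.
rewrite big_split /=; congr (_ + _).
by rewrite (bigD1 a) //= eqxx big1 ?addr0 // => b; rewrite eq_sym => /negbTE ->.
Qed.

Lemma sum_lettersn (F : letter d -> nat) u :
  (\sum_(a <- u) F a = \sum_b count_mem b u * F b)%N.
Proof.
elim: u => [|a u IH]; first by rewrite big_nil big1.
rewrite big_cons IH; under [RHS]eq_bigr do rewrite /= mulnDl.
rewrite big_split /=; congr (_ + _)%N.
rewrite (bigD1 a) //= eqxx big1 ?addn0 ?mul1n // => b.
by rewrite eq_sym => /negbTE ->.
Qed.

Definition some_image theta a : word d :=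
  xchoose (fset0Pn _ (images_neq0 theta a)).

(** For compatible [theta], [cnt] does not depend on the chosen image (see
    [cntE]), and [len theta k a] is the length of every [k]-th image of [a]
    (see [iter_image_len1]). *)
Definition cnt theta b a : nat := count_mem b (some_image theta a).

Fixpoint len theta k a : nat :=
  if k is l.+1 then (\sum_b cnt theta b a * len theta l b)%N else 1%N.

Section Fixed.
Context (theta : random_subst R d) (comp : compatible theta).

Lemma cntE a s b : s \in images theta a -> count_mem b s = cnt theta b a.
Proof.
move=> sa; rewrite /cnt -!occ1; apply: (comp sa).
exact: (xchooseP (fset0Pn _ (images_neq0 theta a))).
Qed.

Lemma image_of_count u w b : image_of theta u w ->
  count_mem b w = (\sum_(a <- u) cnt theta b a)%N.
Proof.
elim: u w => [|a u IH] w; first by move=> /image_of_nil ->; rewrite big_nil.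
case/image_of_cons=> s [y [sa /IH uy ->]].
by rewrite count_cat big_cons uy (cntE _ sa).
Qed.

Lemma iter_image_len k u w : iter_image theta k u w ->
  size w = (\sum_(a <- u) len theta k a)%N.
Proof.
elim: k u w => [|k IH] u w.
  by move=> /iter_image0 ->; rewrite sum1_size.
rewrite -add1n => /iter_image_add[z /iter_image1 uz /IH ->].
rewrite sum_lettersn; under eq_bigr do rewrite (image_of_count _ uz) big_distrl
  /=.
by rewrite exchange_big.
Qed.

Lemma iter_image_len1 k a w : iter_image theta k [:: a] w ->
  size w = len theta k a.
Proof. by move=> /iter_image_len ->; rewrite big_seq1. Qed.

Lemma image_len a s : s \in images theta a -> size s = len theta 1 a.
Proof. by move=> /image_of1/iter_image1/iter_image_len1. Qed.

Lemma len_gt0 k a : (0 < len theta k a)%N.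
Proof.
have [w aw] := iter_image_ex theta k [:: a].
by rewrite -(iter_image_len1 aw); exact: (iter_image_size aw).
Qed.

Lemma sum_image (V : nmodType) (F : letter d -> V) a s : s \in images theta a ->
  \sum_(b <- s) F b = \sum_b F b *+ cnt theta b a.
Proof.
move=> sa; rewrite sum_letters.
by apply: eq_bigr => b _; rewrite (cntE _ sa).
Qed.

Lemma subst_mxE i j : subst_mx theta i j = (cnt theta i j)%:R.
Proof.
rewrite mxE -[RHS]mulr1 -(Ex_letter1 theta j) -Ex_cst.
by apply: eq_Ex => s; rewrite /outcomes -map_comp map_id_in // occ1 => /cntE ->.
Qed.

(** The powers of the substitution matrix count the letters of the iterated
    images, whatever the probabilities of the images. *)
Lemma subst_mx_expE k i j w : iter_image theta k [:: j] w ->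
  (subst_mx theta ^+ k) i j = (count_mem i w)%:R.
Proof.
elim: k i w => [|k IH] i w.
  by move=> /iter_image0 ->; rewrite expr0 mxE /= addn0 eq_sym.
case/iter_imageS=> z jz zw; rewrite exprS mxE (image_of_count _ zw)
  sum_lettersn natr_sum.
apply: eq_bigr => a _.
by rewrite subst_mxE (IH a z) // natrM mulrC.
Qed.

End Fixed.

(** * Powers of a substitution *)

Section Power.
Context (theta : random_subst R d) (n : nat).

Definition power_images a : {fset word d} :=
  [fset w in outcomes (iter_law theta n [:: a])]%fset.

Lemma in_power_images a s : s \in power_images a <->
  iter_image theta n [:: a] s.
Proof. by rewrite in_fset. Qed.

Lemma power_images_neq0 a : power_images a != fset0.
Proof.
have [w aw] := iter_image_ex theta n [:: a].
by apply/fset0Pn; exists w; apply/in_power_images.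
Qed.

Lemma power_images_nonnil a s : s \in power_images a -> s != [::].
Proof. by move=> /in_power_images /iter_image_size; case: s. Qed.

Definition power_weight a (s : word d) : R := (#|` power_images a|%:R)^-1.

Lemma card_power_images_gt0 a : (0 : R) < #|` power_images a|%:R.
Proof. by rewrite ltr0n cardfs_gt0 power_images_neq0. Qed.

Lemma power_weight_gt0 a s : s \in power_images a -> 0 < power_weight a s.
Proof. by move=> _; rewrite invr_gt0 card_power_images_gt0. Qed.

Lemma power_weight_sum1 a : \sum_(s <- power_images a) power_weight a s = 1.
Proof.
rewrite /power_weight big_const_seq count_predT iter_addr_0 -(mulr_natl (_^-1))
  mulfV //.
by rewrite gt_eqF // card_power_images_gt0.
Qed.

(** Among all probabilities on the [n]-th images, the uniform ones give the
    largest entropy. *)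
Definition power : random_subst R d :=
  RandomSubst power_images_neq0 power_images_nonnil power_weight_gt0
    power_weight_sum1.

Lemma image_of_power u w : image_of power u w <-> iter_image theta n u w.
Proof.
elim: u w => [|a u IH] w.
  by rewrite image_of_nil iter_image_nil.
rewrite image_of_cons -cat1s iter_image_cat.
split=> [[s [y [/in_power_images sa /IH uy ->]]]|[s [y [sa uy ->]]]];
  exists s, y; split=> //; [exact/in_power_images | exact/IH].
Qed.

Lemma iter_image_power k u w : iter_image power k u w <->
  iter_image theta (k * n) u w.
Proof.
elim: k w => [|k IH] w; first by rewrite !iter_image0.
rewrite iter_imageS mulSnr iter_image_add.
by split=> -[z /IH uz /image_of_power zw]; exists z.
Qed.

End Power.

Lemma iter_image_count_eq theta : compatible theta -> forall k a w w' b,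
  iter_image theta k [:: a] w -> iter_image theta k [:: a] w' ->
    count_mem b w = count_mem b w'.
Proof.
move=> comp k a w w' b aw aw'; apply/eqP; rewrite -(eqr_nat R).
by rewrite -(subst_mx_expE comp b aw) -(subst_mx_expE comp b aw').
Qed.

Lemma power_compatible theta n : compatible theta -> compatible (power theta n).
Proof.
move=> comp a u v /in_power_images au /in_power_images av b.
by rewrite !occ1; exact: (iter_image_count_eq comp _ au av).
Qed.

Lemma subst_mx_power theta n : compatible theta ->
  subst_mx (power theta n) = subst_mx theta ^+ n.
Proof.
move=> comp; apply/matrixP => i j; have [w jw] := iter_image_ex theta n [:: j].
rewrite (subst_mx_expE comp i jw) subst_mxE; last exact: power_compatible.
congr _%:R; rewrite /cnt; apply: (iter_image_count_eq comp _ _ jw).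
apply/in_power_images.
exact: (xchooseP (fset0Pn _ (images_neq0 (power theta n) j))).
Qed.

(** The combinatorial content of primitivity. *)
Definition spreads theta K :=
  forall a w, iter_image theta K [:: a] w -> forall b, b \in w.

Lemma spreads_le theta K L : (K <= L)%N -> spreads theta K -> spreads theta L.
Proof.
move=> /subnK <- sp a w /iter_image_add[z az zw] b.
have : (0 < size z)%N by exact: (iter_image_size az).
case: z az zw => // c z _ zw _.
have [y cy yw] := iter_image_mem_inv zw (mem_head c z).
exact: (mem_infix yw) (sp _ _ cy b).
Qed.

(** A word that occurs in a [k]-th image also occurs in an image of any larger
    order, since its ancestor occurs in all images of order at least [K]. *)
Lemma language_power theta K n : spreads theta K -> (0 < n)%N ->
  language (power theta n) = language theta.
Proof.
move=> sp n0; apply/seteqP; split=> v /languageP[a [k [w [k0 aw vw]]]];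
  apply/languageP.
  by exists a, (k * n)%N, w; split=> //; [rewrite muln_gt0 k0 |
    apply/iter_image_power].
(* [(K + k) * n] is a multiple of [n] that leaves at least [K] steps before the
   last [k] ones *)
have jK : (K <= (K + k) * n - k)%N by nia.
have [z az] := iter_image_ex theta ((K + k) * n - k) [:: a].
have [y zy wy] := iter_image_mem (spreads_le jK sp az a) aw.
exists a, (K + k)%N, y; split; [by rewrite addn_gt0 k0 orbT | | exact:
  infix_trans wy].
apply/iter_image_power; have -> : ((K + k) * n = ((K + k) * n - k) + k)%N
  by nia.
by apply/iter_image_add; exists z.
Qed.

Lemma subshift_power theta K n : spreads theta K -> (0 < n)%N ->
  subshift (power theta n) = subshift theta.
Proof. by move=> sp n0; rewrite /subshift (language_power sp n0). Qed.

End Compatible.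

(** * Primitivity *)

Section Primitive.
Context {R : realType} {d : nat}.
Implicit Types (M : 'M[R]_d.+1) (theta : random_subst R d) (a b : letter d).

Lemma eigenvalue_exp (F : fieldType) m (M : 'M[F]_m.+1) z n :
  eigenvalue M z -> eigenvalue (M ^+ n) (z ^+ n).
Proof.
case/eigenvalueP=> v vM v0; apply/eigenvalueP; exists v => //.
elim: n => [|n IH]; first by rewrite expr0 mulmx1 scale1r.
by rewrite exprSr -[_ * M]/(_ *m M) mulmxA IH -scalemxAl vM scalerA -exprSr.
Qed.

(** The polynomial [X^n - z] splits over a closed field, so that [M^n - z] is a
    product of matrices [M - y] with [y ^+ n = z], one of which is singular. *)
Lemma eigenvalue_root (F : closedFieldType) m (M : 'M[F]_m.+1) z n :
  (0 < n)%N -> eigenvalue (M ^+ n) z -> exists2 y, eigenvalue M y & y ^+ n = z.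
Proof.
move=> n0 /eigenvalueP[v vM v0].
have [r rE] := closed_field_poly_normal ('X^n - z%:P : {poly F}).
have lc : lead_coef ('X^n - z%:P : {poly F}) = 1 by exact/eqP/monicXnsubC.
rewrite lc scale1r in rE.
have : v *m horner_mx M (\prod_(y <- r) ('X - y%:P)) = 0.
  rewrite -rE rmorphB /= rmorphXn /= horner_mx_X horner_mx_C.
  by rewrite mulmxBr vM mul_mx_scalar subrr.
have : forall y, y \in r -> y ^+ n = z.
  move=> y yr; apply/eqP; rewrite -subr_eq0.
  have : root ('X^n - z%:P) y by rewrite rE root_prod_XsubC.
  by rewrite /root !hornerE.
elim: r v v0 {vM rE} => [|y r IH] v v0 rz.
  by rewrite big_nil rmorph1 mulmx1 => v00; rewrite v00 eqxx in v0.
rewrite big_cons rmorphM /= -[_ * horner_mx _ _]/(_ *m _) mulmxA.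
have [E|nE] := eqVneq (v *m horner_mx M ('X - y%:P)) 0; last first.
  by apply: IH => // x xr; apply: rz; rewrite inE xr orbT.
move=> _; exists y; last by apply: rz; rewrite mem_head.
apply/eigenvalueP; exists v => //; apply/eqP; rewrite -subr_eq0.
move/eqP: E; rewrite rmorphB /= horner_mx_X horner_mx_C.
by rewrite mulmxBr mul_mx_scalar.
Qed.

(** Eigenvalues of a power are powers of eigenvalues, so that domination is
    preserved. *)
Lemma is_PF_eigenvalue_exp M lambda n : (0 < n)%N ->
  is_PF_eigenvalue M lambda -> is_PF_eigenvalue (M ^+ n) (lambda ^+ n).
Proof.
move=> n0 [Ml Mz]; split; first exact: eigenvalue_exp.
move=> z; rewrite rmorphXn /= => /(eigenvalue_root n0)[y /Mz yl <-].
by rewrite normrX rmorphXn /=; apply: lerXn2r; rewrite ?nnegrE //;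
  apply: le_trans yl.
Qed.

Lemma exp_mx_gt0 M n : (0 < n)%N -> (forall i j, 0 < M i j) ->
  forall i j, 0 < (M ^+ n) i j.
Proof.
case: n => // n _ M0; elim: n => [|n IH] i j; first by rewrite expr1.
rewrite exprS mxE (bigD1 ord0) //= ltr_wpDr ?mulr_gt0 //.
by apply: sumr_ge0 => k _; rewrite mulr_ge0 ?ltW.
Qed.

Lemma primitive_power theta n : (0 < n)%N -> compatible theta ->
  primitive_subst theta -> primitive_subst (power theta n).
Proof.
move=> n0 comp [[k k0 M0] [lambda PF l1]]; rewrite /primitive_subst.
rewrite subst_mx_power //; split.
  by exists k => // i j; rewrite exprAC; exact: exp_mx_gt0.
exists (lambda ^+ n); first exact: is_PF_eigenvalue_exp.
by rewrite exprn_egt1 // -lt0n.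
Qed.

(** The second condition makes the lengths of the images grow at least like
    [2 ^ k], also for an alphabet with a single letter. *)
Definition full theta := forall a s, s \in images theta a ->
  (forall b, b \in s) /\ (1 < size s)%N.

Lemma primitive_spreads theta : compatible theta -> primitive_subst theta ->
  exists2 K, (0 < K)%N & spreads theta K.
Proof.
move=> comp [[K K0 M0] _]; exists K => // a w aw b.
by have := M0 b a; rewrite (subst_mx_expE comp b aw) ltr0n -has_pred1 has_count.
Qed.

Lemma primitive_full theta : compatible theta -> primitive_subst theta ->
  exists2 K, (0 < K)%N & spreads theta K /\ full (power theta K).
Proof.
move=> comp prim; have [K K0 sp] := primitive_spreads comp prim.
exists K => //; split=> // a s /in_power_images as'; split; first exact: sp as'.
have [d0|d0] := posnP d; last first.
  rewrite ltnNge; apply/negP => s1.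
  have := sp _ _ as' ord0; have := sp _ _ as' ord_max.
  case: s s1 {as'} => // b [|//] _; rewrite !inE =>
    /eqP <- /eqP /(congr1 val) /=.
  by move=> d0'; rewrite -d0' in d0.
(* with a single letter, the matrix has size 1 and its entry is [lambda > 1] *)
case: prim => _ [lambda [/eigenvalueP[v vM v0] _] l1].
have a0 : all (pred1 a) s.
  by apply/allP => b _; apply/eqP/val_inj; have := ltn_ord a;
    have := ltn_ord b; rewrite /=; lia.
have : (subst_mx theta ^+ K) a a = lambda ^+ K.
  have o (i : letter d) : i = a by apply: val_inj; have := ltn_ord a;
    have := ltn_ord i; rewrite /=; lia.
  have vK : v *m subst_mx theta ^+ K = lambda ^+ K *: v.
    elim: (K) => [|n IH]; first by rewrite expr0 mulmx1 scale1r.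
    by rewrite exprSr -[_ * subst_mx _]/(_ *m subst_mx _) mulmxA IH -scalemxAl
      vM scalerA -exprSr.
  have /rV0Pn[i vi] := v0; rewrite (o i) in vi.
  have := congr1 (fun u : 'rV_d.+1 => u 0 a) vK;
    rewrite !mxE (bigD1 a) //= big1; last first.
    by move=> j; rewrite (o j) eqxx.
  by rewrite addr0 mulrC => /(mulIf vi).
rewrite (subst_mx_expE comp a as') => E.
have : (1 : R) < (count_mem a s)%:R by rewrite E exprn_egt1 // -lt0n.
by rewrite ltr1n => h; apply: leq_trans h _; exact: count_size.
Qed.

Lemma full_power theta n : (0 < n)%N -> full theta -> full (power theta n).
Proof.
move=> n0 ft a s /in_power_images as'.
case: n n0 as' => // n _; rewrite -addn1 =>
  /iter_image_add[z az /iter_image1 zs].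
have z0 : (0 < size z)%N by exact: (iter_image_size az).
case: z z0 zs {az} => // b z _ /image_of_cons[t [y [/ft[tb t1] _ ->]]].
split=> [c|]; first by rewrite mem_cat tb.
by rewrite size_cat ltn_addr.
Qed.

Lemma full_spreads theta : full theta -> spreads theta 1.
Proof. by move=> ft a w /iter_image1/image_of1/ft[]. Qed.

End Primitive.

(** * Contraction by averaging *)

Section Contraction.
Context {R : realType}.

Lemma ex_min (I : finType) (i0 : I) (F : I -> R) :
  exists j, forall i, F j <= F i.
Proof.
by case: (@Order.TotalTheory.arg_minP _ _ _ i0 xpredT F) => // j _ jF;
  exists j => i; exact: jF.
Qed.

Lemma cvg_expV2 (C : R) : (fun k => C / 2 ^+ k) @ \oo --> (0 : R).
Proof.
have : `|2^-1| < 1 :> R by rewrite ger0_norm ?invr_ge0 // invf_lt1 ?ltr1n.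
move=> /(cvg_geometric C); rewrite /geometric /=.
by under eq_fun do rewrite exprVn.
Qed.

(** The minimum of [phi k] increases with [k]. An average in which every value,
    hence the smallest one, has weight at least [delta] stays away from the
    maximum by [delta] times the oscillation, so that the oscillation tends to
    0. The last claim records that lower bounds persist. *)
Lemma averaging_cvg (I : finType) (i0 : I) (phi : nat -> I -> R)
    (p : nat -> I -> I -> R) (delta C : R) :
  0 < delta -> (forall k b a, delta <= p k b a) ->
  (forall k a, \sum_b p k b a = 1) ->
  (forall k a, \sum_b p k b a * phi k b <= phi k.+1 a
               <= \sum_b p k b a * phi k b + C / 2 ^+ k) ->
  exists h, (forall a, phi ^~ a @ \oo --> h) /\
    (forall k x, (forall a, x <= phi k a) -> x <= h).
Proof.
move=> delta0 pd p1 phiS.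
have p0 k b a : 0 <= p k b a by exact: le_trans (ltW delta0) (pd k b a).
have /choice[jm jmP] : forall k, exists j, forall i, phi k j <= phi k i.
  by move=> k; exact: ex_min.
have /choice[jM jMP] : forall k, exists j, forall i, phi k i <= phi k j.
  move=> k; have [j jP] := ex_min i0 (fun i => - phi k i).
  by exists j => i; rewrite -lerN2.
pose lo k := phi k (jm k); pose hi k := phi k (jM k).
have C0 k : 0 <= C / 2 ^+ k.
  by have /andP[h1 h2] := phiS k i0; have := le_trans h1 h2; rewrite lerDl.
have loS k : lo k <= lo k.+1.
  have /andP[+ _] := phiS k (jm k.+1); apply: le_trans.
  rewrite -[lo k]mul1r -(p1 k (jm k.+1)) mulr_suml.
  by apply: ler_sum => b _; rewrite ler_wpM2l // jmP.
have hiS k : hi k.+1 <= hi k - delta * (hi k - lo k) + C / 2 ^+ k.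
  have /andP[_ h] := phiS k (jM k.+1); apply: le_trans h _; rewrite lerD2r.
  rewrite lerBrDl addrC -lerBrDl -[X in _ <= X - _]mul1r -(p1 k (jM k.+1))
    mulr_suml -sumrB.
  rewrite (bigD1 (jm k)) //= -mulrBr ler_wpDr ?ler_wpM2r ?subr_ge0 ?jMP //.
  by apply: sumr_ge0 => b _; rewrite -mulrBr mulr_ge0 // subr_ge0 jMP.
(* the correction bounds the sum of all errors from time [k] on *)
pose v k := hi k + 2 * (C / 2 ^+ k).
have vS k : v k.+1 <= v k.
  rewrite /v; have := hiS k.
  have : 0 <= delta * (hi k - lo k) by rewrite mulr_ge0 ?subr_ge0 ?jMP // ltW.
  have -> : 2 * (C / 2 ^+ k.+1) = C / 2 ^+ k.
    by rewrite exprS; field; rewrite expf_neq0 // pnatr_eq0.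
  lra.
have lohi k : lo k <= hi k by exact: jmP.
have lov k : lo k <= v k.
  by apply: le_trans (lohi k) _; rewrite /v lerDl mulr_ge0.
have nlo : {homo lo : n m / (n <= m)%N >-> n <= m} by apply/nondecreasing_seqP.
have nv : {homo v : n m / (n <= m)%N >-> m <= n} by apply/nonincreasing_seqP.
have clo : cvgn lo.
  apply: nondecreasing_is_cvgn => //; exists (v 0%N) => _ [k _ <-].
  by apply: le_trans (lov k) _; exact: nv.
have cv : cvgn v.
  apply: nonincreasing_is_cvgn => //; exists (lo 0%N) => _ [k _ <-].
  by apply: le_trans (lov k); exact: nlo.
set h := lim (lo @ \oo) in clo; set g := lim (v @ \oo) in cv.
have chi : hi @ \oo --> g.
  have -> : hi = (fun k => v k - 2 * (C / 2 ^+ k)) by apply/funext => k;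
    rewrite /v addrK.
  rewrite -[g]subr0 -[X in _ - X](mulr0 2).
  by apply: cvgB => //; apply: cvgM; [exact: cvg_cst | exact: cvg_expV2].
have hg : h <= g by apply: (ler_cvg_to clo chi); exact: nearW.
have gh : g <= h.
  have : g <= g - delta * (g - h) + 0.
    have c1 : [sequence hi k.+1]_k @ \oo --> g by rewrite (cvg_shiftS hi).
    have c2 : (fun k => hi k - delta * (hi k - lo k) + C / 2 ^+ k) @ \oo -->
        g - delta * (g - h) + 0.
      apply: cvgD; last exact: cvg_expV2.
      by apply: cvgB => //; apply: cvgM; [exact: cvg_cst | exact: cvgB].
    by apply: (ler_cvg_to c1 c2); exact: nearW.
  rewrite addr0 => E; have : delta * (g - h) <= 0 by lra.
  by rewrite pmulr_rle0 // subr_le0.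
exists h; split=> [a|k x xk].
  apply: (@squeeze_cvgr _ _ _ _ lo hi) => //.
    by apply: nearW => k; rewrite jmP jMP.
  by rewrite (le_anti (introT andP (conj hg gh))).
apply: le_trans (xk (jm k)) _.
exact: (nondecreasing_cvgn_le nlo clo).
Qed.

End Contraction.

Section Kernel.
Context {R : realType} {d : nat} (theta : random_subst R d).
Context (comp : compatible theta) (fu : full theta).
Implicit Types (a b c : letter d) (u v w y z s : word d) (k : nat).

Notation cnt := (cnt theta).
Notation len := (len theta).

Lemma cnt_gt0 b a : (0 < cnt b a)%N.
Proof.
have /fset0Pn[s sa] := images_neq0 theta a.
rewrite -(cntE comp b sa) -has_count has_pred1.
by case: (fu sa).
Qed.

Lemma sum_cnt_ge2 a : (2 <= \sum_b cnt b a)%N.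
Proof.
have /fset0Pn[s sa] := images_neq0 theta a.
have [_] := fu sa; rewrite (image_len comp sa) /=.
by under eq_bigr do rewrite muln1.
Qed.

Lemma len_ge_exp k a : (2 ^ k <= len k a)%N.
Proof.
elim: k a => [//|k IH] a; rewrite expnS /=.
apply: leq_trans (leq_mul (sum_cnt_ge2 a) (leqnn _)) _.
by rewrite big_distrl; apply: leq_sum => b _; rewrite leq_mul2l IH orbT.
Qed.

(** The proportion of the [k.+1]-st image of [a] that comes from the
    descendants of the letters [b] in the first image. *)
Definition share k b a : R := (cnt b a * len k b)%:R / (len k.+1 a)%:R.

Lemma lenR_gt0 k a : 0 < (len k a)%:R :> R.
Proof. by rewrite ltr0n len_gt0. Qed.

Lemma share_sum1 k a : \sum_b share k b a = 1.
Proof.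
by rewrite /share -mulr_suml -natr_sum -[(\sum_b _)%N]/(len k.+1 a) divff //
  gt_eqF // lenR_gt0.
Qed.

(** The lengths of the [k]-th images of two letters differ by at most a factor
    that does not depend on [k], because every first image contains all
    letters. *)
Lemma share_ge :
  exists2 delta : R, 0 < delta & forall k b a, delta <= share k b a.
Proof.
pose C := (\sum_a \sum_b cnt a b)%N.
have cC b a : (cnt b a <= C)%N.
  by rewrite /C (bigD1 b) //= (bigD1 a) //= -addnA leq_addr.
have C0 : (0 < C)%N by exact: leq_trans (cnt_gt0 ord0 ord0) (cC _ _).
have lC k b b' : (len k b <= C * len k b')%N.
  case: k => [|k] /=; first by rewrite muln1.
  rewrite big_distrr; apply: leq_sum => c _ /=.
  by rewrite mulnA leq_mul2r (leq_trans (cC c b)) ?orbT // leq_pmulr // cnt_gt0.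
exists ((C * C)%:R^-1); first by rewrite invr_gt0 ltr0n muln_gt0 C0.
move=> k b a; rewrite /share ler_pdivlMr ?lenR_gt0 // ler_pdivrMl; last first.
  by rewrite ltr0n muln_gt0 C0.
rewrite -natrM ler_nat /= .
have : (\sum_c cnt c a * len k c <= \sum_c cnt c a * (C * len k b))%N.
  by apply: leq_sum => c _; rewrite leq_mul2l lC orbT.
move=> /leq_trans; apply; rewrite -big_distrl /= mulnA leq_mul //; last first.
  by rewrite leq_pmull // cnt_gt0.
rewrite leq_mul2r; apply/orP; right.
by rewrite /C; apply: leq_sum => c _; rewrite (bigD1 a) //= leq_addr.
Qed.

Lemma len1_le k a (e : R) : 0 <= e ->
  (len 1 a)%:R * e / (len k.+1 a)%:R <= e / 2 ^+ k.
Proof.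
move=> e0; rewrite ler_pdivrMr ?lenR_gt0 // mulrAC mulrC.
have : (len 1 a * 2 ^ k <= len k.+1 a)%N.
  rewrite /= big_distrl; apply: leq_sum => b _.
  by rewrite muln1 leq_mul2l len_ge_exp orbT.
rewrite -(ler_nat R) natrM natrX => h.
by rewrite -mulrA ler_wpM2l // ler_pdivlMr // exprn_gt0.
Qed.

(** * Frequencies of words *)

Definition mean_occ v k a : R :=
  Ex (iter_law theta k [:: a]) (fun w => (occ v w)%:R).

Lemma mean_len k a :
  Ex (iter_law theta k [:: a]) (fun w => (size w)%:R) = (len k a)%:R.
Proof.
rewrite -[RHS]mulr1 -(Ex_iter_one theta k [:: a]) -Ex_cst.
by apply: eq_Ex => w /(iter_image_len1 comp) ->.
Qed.

(** An occurrence in a concatenation of images lies in one of the images or is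
    one of the at most [size v] occurrences that start in an image and end
    beyond it. *)
Lemma mean_occ_word v k u :
  let F := \sum_(b <- u) mean_occ v k b in
  F <= Ex (iter_law theta k u) (fun w => (occ v w)%:R)
    <= F + (size u * size v)%:R.
Proof.
elim: u => [|a u]; cbv zeta.
  rewrite big_nil add0r mul0n.
  suff -> : Ex (iter_law theta k [::]) (fun w => (occ v w)%:R) = 0 :> R
    by rewrite lexx.
  rewrite -[RHS](mul0r (Ex (iter_law theta k [::]) (fun=> 1))) -Ex_cst.
  by apply: eq_Ex => w /iter_image_nil ->.
set E := Ex (iter_law theta k u) _ => /andP[h1 h2].
rewrite big_cons -cat1s Ex_iter_cat.
set L := iter_law theta k [:: a]; set L' := iter_law theta k u.
have L0 : positive_law L by exact: positive_iter.
have L0' : positive_law L' by exact: positive_iter.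
have sumE (r : R) : mean_occ v k a + E + r =
    Ex L (fun y => Ex L' (fun z => (occ v y)%:R + (occ v z)%:R + r)).
  transitivity (Ex L (fun y => (occ v y)%:R + (E + r))).
    by rewrite ExD Ex_cst Ex_iter_one mulr1 addrA.
  apply: eq_Ex => y _; rewrite !ExD (Ex_cst _ r) (Ex_cst _ (occ v y)%:R).
  by rewrite Ex_iter_one !mulr1 addrA.
apply/andP; split.
  apply: (@le_trans _ _ (mean_occ v k a + E + 0));
    first by rewrite addr0 lerD2l.
  rewrite sumE; apply: le_Ex => // y _; apply: le_Ex => // z _.
  by rewrite addr0 -natrD ler_nat occ_cat_ge.
apply: (@le_trans _ _ (mean_occ v k a + E + (size v)%:R)); last first.
  by rewrite /= mulSn natrD addrA addrAC lerD2r -addrA lerD2l.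
rewrite sumE; apply: le_Ex => // y _; apply: le_Ex => // z _.
by rewrite -!natrD ler_nat occ_cat_le.
Qed.

Lemma mean_occS v k a : let F := \sum_b (cnt b a)%:R * mean_occ v k b in
  F <= mean_occ v k.+1 a <= F + (len 1 a * size v)%:R.
Proof.
cbv zeta; set F := \sum_b _.
have H s : s \in images theta a ->
    F <= Ex (iter_law theta k s) (fun w => (occ v w)%:R)
      <= F + (len 1 a * size v)%:R.
  move=> sa; have := mean_occ_word v k s; rewrite (sum_image comp _ sa)
    (image_len comp sa).
  by rewrite /F; under [in X in _ -> X]eq_bigr do rewrite mulr_natl.
rewrite /mean_occ Ex_iterSl Ex_word1.
have cE (r : R) : r = Ex (letter_law theta a) (fun=> r)
  by rewrite Ex_cst Ex_letter1 mulr1.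
rewrite {1}[F]cE [X in _ <= _ <= X]cE.
by apply/andP; split; apply: le_Ex; try exact: positive_letter;
  move=> s /mapP[_ /mapP[t ta ->] ->]; case/andP: (H _ ta).
Qed.

(** Up to boundary effects, the frequency of [v] in the [k.+1]-st images of [a]
    is the average, with weights [share], of its frequencies in the [k]-th
    images of the letters. *)
Lemma frequency_exists v : exists h,
  (forall a, (fun k => mean_occ v k a / (len k a)%:R) @ \oo --> h) /\
  (forall k x, (forall a, x <= mean_occ v k a / (len k a)%:R) -> x <= h).
Proof.
have [delta d0 dP] := share_ge.
apply: (@averaging_cvg R _ ord0 _ share delta (size v)%:R) => // [|k a].
  exact: share_sum1.
have E : \sum_b share k b a * (mean_occ v k b / (len k b)%:R) =
    (\sum_b (cnt b a)%:R * mean_occ v k b) / (len k.+1 a)%:R.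
  rewrite mulr_suml; apply: eq_bigr => b _; rewrite /share natrM.
  by field; rewrite !gt_eqF // lenR_gt0.
rewrite E; have /andP[h1 h2] := mean_occS v k a; apply/andP; split.
  by rewrite ler_pM2r // invr_gt0 lenR_gt0.
rewrite -lerBlDl -mulrBl; apply: le_trans (len1_le k a (ler0n R (size v))).
by rewrite ler_pM2r ?invr_gt0 ?lenR_gt0 // lerBlDl -natrM.
Qed.

End Kernel.

(** * Invariant word weights and their block entropies *)

Section Weights.
Context {R : realType} {d : nat}.
Implicit Types (theta : random_subst R d) (a b c : letter d).
Implicit Types (u v w y z s : word d) (m : word d -> R).

Lemma cvg_fsum (I : finType) (F : I -> nat -> R) (l : I -> R) :
  (forall i, F i @ \oo --> l i) ->
  (fun k => \sum_i F i k) @ \oo --> \sum_i l i.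
Proof.
move=> Fl; elim: (index_enum I) => [|i r IH].
  rewrite big_nil; under eq_fun do rewrite big_nil.
  exact: cvg_cst.
rewrite big_cons; under eq_fun do rewrite big_cons.
exact: cvgD.
Qed.

(** These are the functions that give the values of a shift-invariant
    probability measure on cylinders. *)
Record invariant_weight m : Prop := InvariantWeight {
  iw_ge0 : forall v, 0 <= m v;
  iw_nil : m [::] = 1;
  iw_rcons : forall v, \sum_a m (rcons v a) = m v;
  iw_cons : forall v, \sum_a m (a :: v) = m v
}.

Lemma sum_tuple_cons n (F : word d -> R) :
  \sum_(u : n.+1.-tuple (letter d)) F u =
  \sum_a \sum_(u : n.-tuple (letter d)) F (a :: u).
Proof.
rewrite pair_big /=.
rewrite (reindex (fun p : letter d * n.-tuple (letter d) =>
  [tuple of p.1 :: p.2])) //=.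
exists (fun t : n.+1.-tuple (letter d) => (thead t, [tuple of behead t])) =>
  [[a t]|t] _ /=.
  by congr (_, _); apply: val_inj.
by rewrite [in RHS](tuple_eta t); apply: val_inj.
Qed.

Lemma sum_tuple0 (F : word d -> R) :
  \sum_(u : 0.-tuple (letter d)) F u = F [::].
Proof.
rewrite (eq_bigr (fun=> F [::])) => [|u _]; last by rewrite (tuple0 u).
by rewrite sumr_const card_tuple expn0.
Qed.

Lemma sum_weight m n : invariant_weight m ->
  \sum_(u : n.-tuple (letter d)) m u = 1.
Proof.
move=> im; elim: n => [|n IH]; first by rewrite sum_tuple0 iw_nil.
by rewrite sum_tuple_cons exchange_big -IH; apply: eq_bigr => u _;
  rewrite iw_cons.
Qed.

Lemma weight_cons_le m a v : invariant_weight m -> m (a :: v) <= m v.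
Proof.
move=> im; rewrite -[leRHS](iw_cons im) (bigD1 a) //= lerDl.
by apply: sumr_ge0 => b _; exact: iw_ge0.
Qed.

Lemma weight_le1 m v : invariant_weight m -> m v <= 1.
Proof.
move=> im; elim: v => [|a v IH]; first by rewrite iw_nil.
exact: le_trans (weight_cons_le a v im) IH.
Qed.

(** The conditional weight of a letter given the letters that follow it. *)
Definition cond_weight m v : R := m v / m (behead v).

Definition block_entropy m n : R :=
  \sum_(u : n.-tuple (letter d)) - (m u * ln (m u)).

(** The chain rule: the block of length [n] that ends a block of length [n.+1]
    has the entropy of the blocks of length [n], by invariance. *)
Lemma block_entropyS m n : invariant_weight m ->
  block_entropy m n.+1 - block_entropy m n =
  \sum_(u : n.+1.-tuple (letter d)) m u * - ln (cond_weight m u).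
Proof.
move=> im; rewrite /block_entropy.
rewrite (sum_tuple_cons n (fun u => - (m u * ln (m u)))).
rewrite (sum_tuple_cons n (fun u => m u * - ln (cond_weight m u))).
rewrite exchange_big [RHS]exchange_big -sumrB; apply: eq_bigr => u _ /=.
rewrite -{1}(iw_cons im u) mulr_suml opprK -big_split; apply: eq_bigr => a _ /=.
rewrite /cond_weight /=; have := iw_ge0 im (a :: u).
rewrite le_eqVlt => /orP[/eqP <-|au]; first by rewrite !mul0r oppr0 addr0.
have u0 : 0 < m u by exact: lt_le_trans au (weight_cons_le a u im).
by rewrite ln_div ?posrE // opprB mulrBr addrC.
Qed.

Lemma ln_le_subr1 (x : R) : 0 < x -> ln x <= x - 1.
Proof. by move=> x0; rewrite -{1}(subrK 1 x) addrC le_ln1Dx //; lra. Qed.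

(** Gibbs' inequality for a uniform law: average the bound [ln (D * Q w) <= D *
    Q w - 1]. *)
Lemma gibbs_uniform (L : law R d) (D : R) (Q : word d -> R) : 0 < D ->
  (forall x, x \in L -> x.1 = D^-1) -> Ex L (fun=> 1) = 1 ->
  {in outcomes L, forall w, 0 < Q w} -> \sum_(w <- outcomes L) Q w <= 1 ->
  ln D <= Ex L (fun w => - ln (Q w)).
Proof.
move=> D0 LD L1 Q0 Q1.
have Lpos : positive_law L by move=> x /LD ->; rewrite invr_gt0.
apply: (@le_trans _ _ (Ex L (fun w => (ln D + 1) + (- D) * Q w))); last first.
  apply: le_Ex => // w /Q0 wQ.
  have := @ln_le_subr1 (D * Q w) (mulr_gt0 D0 wQ).
  by rewrite lnM ?posrE //; lra.
rewrite ExD ExZ Ex_cst L1 mulr1.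
have -> : Ex L Q = D^-1 * \sum_(w <- outcomes L) Q w.
  by rewrite /Ex big_map mulr_sumr !big_seq; apply: eq_bigr => x /LD ->.
by rewrite mulrA mulNr divff ?gt_eqF // mulN1r; lra.
Qed.

Lemma sum_uniq_le n (s : seq (word d)) (Q : word d -> R) : uniq s ->
  {in s, forall w, size w = n} -> (forall w, 0 <= Q w) ->
  \sum_(w <- s) Q w <= \sum_(u : n.-tuple (letter d)) Q u.
Proof.
move=> us sn Q0.
have -> : s = [seq tval t | t <- pmap (insub : word d ->
  option (n.-tuple (letter d))) s].
  rewrite pmap_filter; last by move=> x; exact: insubK.
  by apply/esym/all_filterP/allP => w /sn wn; rewrite isSome_insub wn.
rewrite big_map big_uniq /=; last exact: pmap_sub_uniq.
rewrite [leRHS](bigID (mem (pmap (insub : word d ->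
  option (n.-tuple (letter d))) s))) /=.
by rewrite lerDl sumr_ge0.
Qed.

End Weights.

Section MarkovWeight.
Context {R : realType} {d : nat} (m : word d -> R) (N : nat).
Context (im : invariant_weight m).
Implicit Types (a b : letter d) (u v w : word d).

(** A window that is cut by the end of the word gets the uniform weight, so
    that the weights of the letters that may precede a word always add up to at
    most 1. *)
Definition window_weight w : R :=
  if size w == N.+1 then cond_weight m w else (d.+1)%:R^-1.

(** The weight of a word under the Markov chain of memory [N], run backwards,
    whose transition probabilities are the conditional weights of [m]. *)
Fixpoint markov_weight u : R :=
  if u is a :: v then window_weight (take N.+1 u) * markov_weight v else 1.

Lemma window_weight_ge0 w : 0 <= window_weight w.
Proof.
rewrite /window_weight; case: ifP => _; last by rewrite invr_ge0.
by rewrite divr_ge0 // iw_ge0.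
Qed.

Lemma markov_weight_ge0 u : 0 <= markov_weight u.
Proof. by elim: u => //= a u IH; rewrite mulr_ge0 // window_weight_ge0. Qed.

Lemma sum_window_weight v : \sum_a window_weight (take N.+1 (a :: v)) <= 1.
Proof.
rewrite /window_weight /=; have [vN|vN] := leqP N (size v); last first.
  have -> : ((size (take N v)).+1 == N.+1) = false.
    by rewrite eqSS size_take; apply/eqP; case: ifP => h; lia.
  by rewrite sumr_const card_ord -(mulr_natl (_^-1)) divff // pnatr_eq0.
rewrite size_takel // eqxx /cond_weight /=.
rewrite -mulr_suml iw_cons //.
have [->|nz] := eqVneq (m (take N v)) 0; first by rewrite mul0r.
by rewrite divff.
Qed.

Lemma sum_markov_weight n :
  \sum_(u : n.-tuple (letter d)) markov_weight u <= 1.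
Proof.
elim: n => [|n IH]; first by rewrite sum_tuple0.
rewrite sum_tuple_cons exchange_big /=; apply: le_trans IH.
apply: ler_sum => u _; rewrite -mulr_suml.
rewrite -[leRHS]mul1r ler_wpM2r ?markov_weight_ge0 //.
exact: sum_window_weight.
Qed.

Lemma cond_weight_gt0 w : 0 < m w -> 0 < cond_weight m w.
Proof.
move=> w0; rewrite divr_gt0 //; case: w w0 => //= a w aw.
exact: lt_le_trans aw (weight_cons_le a w im).
Qed.

Lemma window_weight_gt0 w : 0 < m w -> 0 < window_weight w.
Proof.
move=> w0; rewrite /window_weight; case: ifP => _; last by rewrite invr_gt0.
exact: cond_weight_gt0.
Qed.

Lemma markov_weight_gt0 u : (forall v, infix v u -> 0 < m v) ->
  0 < markov_weight u.
Proof.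
elim: u => //= a u IH mu; rewrite mulr_gt0 //; last first.
  by apply: IH => v vu; apply: mu; exact: infix_trans vu (infix_cons _ _).
by apply/window_weight_gt0/mu; exact: (infix_take (a :: u) N.+1).
Qed.

(** All but the last [N] factors of the Markov weight are conditional weights
    of windows of length [N.+1]. *)
Lemma ln_markov_weight u : (forall v, infix v u -> 0 < m v) ->
  - ln (markov_weight u) <=
  \sum_(v : N.+1.-tuple (letter d)) (occ v u)%:R * - ln (cond_weight m v)
  + N%:R * ln (d.+1)%:R.
Proof.
move=> mu.
suff : - ln (markov_weight u) =
  \sum_(v : N.+1.-tuple (letter d)) (occ v u)%:R * - ln (cond_weight m v)
  + (minn (size u) N)%:R * ln (d.+1)%:R.
  move=> ->; rewrite lerD2l ler_wpM2r //; first by rewrite ln_ge0 // ler1n.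
  by rewrite ler_nat geq_minr.
elim: u mu => [|a u IH] mu.
  by rewrite /= ln1 oppr0 min0n mul0r addr0 big1 // => v _; rewrite mul0r.
have mu' v : infix v u -> 0 < m v.
  by move=> vu; apply: mu; exact: infix_trans vu (infix_cons _ _).
have -> : markov_weight (a :: u) = window_weight (take N.+1 (a :: u)) *
  markov_weight u by [].
rewrite lnM ?posrE ?markov_weight_gt0 //;
  last exact/window_weight_gt0/mu/infix_take.
rewrite opprD IH // addrA.
have -> : \sum_(v : N.+1.-tuple (letter d)) (occ v (a :: u))%:R * - ln
  (cond_weight m v) =
  \sum_(v : N.+1.-tuple (letter d)) (prefix v (a :: u))%:R * - ln (cond_weight
    m v) +
  \sum_(v : N.+1.-tuple (letter d)) (occ v u)%:R * - ln (cond_weight m v).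
  by rewrite -big_split; apply: eq_bigr => v _; rewrite occ_cons natrD mulrDl.
have pE (v : N.+1.-tuple (letter d)) : prefix v (a :: u) = (take N.+1 (a :: u)
  == v).
  by rewrite prefixE size_tuple.
under [in RHS]eq_bigr do rewrite pE.
rewrite /window_weight; case: eqP => [sz|sz]; last first.
  rewrite [X in _ = X + _ + _]big1 => [|v _]; last first.
    case: eqP => [E|]; last by rewrite mul0r.
    by case: sz; rewrite E size_tuple.
  rewrite add0r lnV ?posrE ?ltr0n // opprK.
  have uN : (size u < N)%N.
    by move: sz; rewrite size_take /=; case: ltnP => h; lia.
  rewrite (minn_idPl (ltnW uN)) (minn_idPl _) // -[size (a :: u)]/(size u).+1.
  by rewrite -(natr1 (size u)) mulrDl mul1r; lra.
have uN : (N <= size u)%N by move: sz; rewrite size_take /=; case: ltnP => h;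
  lia.
have -> : \sum_(v : N.+1.-tuple (letter d))
    (take N.+1 (a :: u) == v)%:R * - ln (cond_weight m v) =
    - ln (cond_weight m (take N.+1 (a :: u))).
  rewrite (bigD1 (Tuple (introT eqP sz))) // big1 => [|v vn].
    by rewrite [tval _]/= eqxx mul1r /= addr0.
  case: eqP => [E|_]; last by rewrite mul0r.
  by case/eqP: vn; apply: val_inj; rewrite /= -E.
rewrite (minn_idPr uN) (minn_idPr _) //.
by rewrite (leq_trans uN) //= leqnSn.
Qed.

End MarkovWeight.

(** * Frequencies as invariant weights *)

Section Frequencies.
Context {R : realType} {d : nat} (theta : random_subst R d).
Context (comp : compatible theta) (fu : full theta).
Implicit Types (a b c : letter d) (u v w y z s : word d) (k : nat).
Implicit Types (m : word d -> R).

Definition is_frequency m := forall v a,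
  (fun k => mean_occ theta v k a / (len theta k a)%:R) @ \oo --> m v.

Lemma cvg_close (f g : nat -> R) (l l' C : R) : f @ \oo --> l ->
  g @ \oo --> l' ->
  (forall k, `|f k - g k| <= C / 2 ^+ k) -> l = l'.
Proof.
move=> fl gl fg; apply/eqP; rewrite -subr_eq0 -normr_le0.
have c1 : (fun k => `|f k - g k|) @ \oo --> `|l - l'| by apply: cvg_norm;
  exact: cvgB.
by apply: (ler_cvg_to c1 (cvg_expV2 C)); apply: nearW => k; exact: fg.
Qed.

Lemma mean_occ_ge0 v k a : 0 <= mean_occ theta v k a.
Proof.
rewrite -[leLHS](mul0r (Ex (iter_law theta k [:: a]) (fun=> 1))) -Ex_cst.
by apply: le_Ex => //; exact: positive_iter.
Qed.

Lemma invV_len k a : 1 / (len theta k a)%:R <= 1 / 2 ^+ k :> R.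
Proof.
rewrite !div1r lef_pV2 ?posrE ?exprn_gt0 ?lenR_gt0 //.
by rewrite -natrX ler_nat len_ge_exp.
Qed.

Lemma norm_natB_le1 (x y : nat) : (x <= y + 1)%N -> (y <= x + 1)%N ->
  `|x%:R - y%:R| <= 1 :> R.
Proof.
by rewrite -!(ler_nat R) !natrD => h1 h2; rewrite ler_norml; apply/andP;
  split; lra.
Qed.

Lemma mean_occ_sum v k a (g : letter d -> word d) :
  (forall w, \sum_b occ (g b) w <= occ v w + 1)%N ->
  (forall w, occ v w <= \sum_b occ (g b) w + 1)%N ->
  `|\sum_b (mean_occ theta (g b) k a / (len theta k a)%:R) -
    mean_occ theta v k a / (len theta k a)%:R| <= 1 / 2 ^+ k.
Proof.
move=> gv vg; rewrite -mulr_suml -mulrBl.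
apply: le_trans (invV_len k a).
rewrite normrM [X in _ * X]ger0_norm ?invr_ge0 // ler_wpM2r ?invr_ge0 //.
set L := iter_law theta k [:: a].
have L0 : positive_law L by exact: positive_iter.
have -> : \sum_b mean_occ theta (g b) k a - mean_occ theta v k a =
    Ex L (fun w => \sum_b (occ (g b) w)%:R + (-1) * (occ v w)%:R).
  by rewrite ExD ExZ Ex_sum mulN1r.
have E1 (r : R) : Ex L (fun=> r) = r by rewrite Ex_cst Ex_iter_one mulr1.
have H w : (-1 <= \sum_b (occ (g b) w)%:R + (-1) * (occ v w)%:R :> R) &&
    (\sum_b (occ (g b) w)%:R + (-1) * (occ v w)%:R <= 1 :> R).
  by have := norm_natB_le1 (gv w) (vg w); rewrite ler_norml natr_sum !mulN1r.
rewrite ler_norml; apply/andP; split; [rewrite -[leLHS]E1 | rewrite -[leRHS]E1];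
  by apply: le_Ex => // w _; case/andP: (H w).
Qed.

Lemma Ex_gt0 (L : law R d) (f : word d -> R) w : positive_law L ->
  (forall z, 0 <= f z) -> w \in outcomes L -> 0 < f w -> 0 < Ex L f.
Proof.
move=> L0 f0 /mapP[x xL ->] fx.
rewrite /Ex (big_rem x) //= ltr_wpDr ?mulr_gt0 ?L0 //.
by rewrite big_seq; apply: sumr_ge0 => y /mem_rem /L0/ltW y0; exact: mulr_ge0.
Qed.

(** The numbers of occurrences satisfy the equations of an invariant weight up
    to an error of at most 1, which vanishes in the limit. A word of the
    language occurs in the images of all letters from some time on, and the
    averaging keeps its frequency above the lower bound that this gives. *)
Lemma frequency_weight : exists m, [/\ is_frequency m, invariant_weight m,
  forall v, language theta v -> 0 < m v &
  forall v, ~ language theta v -> m v = 0].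
Proof.
have /choice[m mP] := frequency_exists comp fu.
have mF : is_frequency m by move=> v; have [] := mP v.
exists m; split=> //.
- split=> [v||v|v].
  + apply: (cvgr_to_ge (mF v ord0)); apply: nearW => k.
    by rewrite divr_ge0 // mean_occ_ge0.
  + apply: (@cvg_unique _ (@Rhausdorff R)) (mF [::] ord0) _.
    rewrite (_ : (fun _ => _) = fun=> 1); first exact: cvg_cst.
    apply/funext => k.
    rewrite -(mean_len comp k ord0) /mean_occ.
    under eq_Ex do rewrite occ_nil.
    by rewrite (mean_len comp) divff // gt_eqF // lenR_gt0.
  + have c := cvg_fsum (fun b => mF (rcons v b) ord0).
    apply: (cvg_close c (mF v ord0) (C := 1)) => k.
    by apply: mean_occ_sum => w; have /andP[] := sum_occ_rcons v w; lia.
  + have c := cvg_fsum (fun b => mF (b :: v) ord0).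
    apply: (cvg_close c (mF v ord0) (C := 1)) => k.
    apply: mean_occ_sum => w; have := sum_occ_cons v w;
      by case: (v == [::]); case: (prefix v w) => /=; lia.
- move=> v /languageP[a [k [w [k0 aw vw]]]].
  have b0 b : 0 < mean_occ theta v k.+1 b / (len theta k.+1 b)%:R.
    rewrite divr_gt0 ?lenR_gt0 //.
    have [z' bz'] := iter_image_ex theta 1 [:: b].
    have [y zy wy] := iter_image_mem (full_spreads fu bz' a) aw.
    apply: (@Ex_gt0 _ _ y) => //; first exact: positive_iter.
      by rewrite -/(iter_image _ _ _ _) -add1n; apply/iter_image_add; exists z'.
    rewrite ltr0n; apply: infix_occ_gt0; last exact: infix_trans vw wy.
    apply: leq_trans (size_infix wy).
    by have := iter_image_size aw.
  have [j jP] := ex_min ord0 (fun b => mean_occ theta v k.+1 b / (len theta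
    k.+1 b)%:R).
  apply: lt_le_trans (b0 j) _.
  by have [_ /(_ k.+1 _ jP)] := mP v.
- move=> v nv; apply: (@cvg_unique _ (@Rhausdorff R)) (mF v ord0) _.
  apply: (@cvg_near_cst _ _ _ _ \oo); near=> k.
  suff -> : mean_occ theta v k ord0 = 0 by rewrite mul0r.
  rewrite -[RHS](mul0r (Ex (iter_law theta k [:: ord0]) (fun=> 1))) -Ex_cst.
  apply: eq_Ex => w wE /=.
  apply/eqP; rewrite pnatr_eq0 -leqn0 leqNgt; apply/negP => /occ_gt0_infix vw.
  apply: nv; apply/languageP; exists ord0, k, w; split=> //.
  by near: k; exists 1%N.
Unshelve. all: by end_near. Qed.

End Frequencies.

(** * Counting images *)

Section Counting.
Context {R : realType} {d : nat}.
Implicit Types (theta : random_subst R d) (a b c : letter d).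
Implicit Types (u v w y z s : word d) (k : nat).

Lemma outcomes_word_cons theta a u : outcomes (word_law theta (a :: u)) =
  [seq s ++ y | s <- images theta a, y <- outcomes (word_law theta u)].
Proof.
rewrite /outcomes /= map_allpairs /allpairs_dep allpairs_mapl.
by rewrite allpairs_mapr.
Qed.

(** Images of the same letter having the same length, a concatenation of images
    determines its factors. *)
Lemma uniq_word_outcomes theta u : compatible theta ->
  uniq (outcomes (word_law theta u)).
Proof.
move=> comp; elim: u => [//|a u IH]; rewrite outcomes_word_cons.
apply: allpairs_uniq IH _; first exact: fset_uniq.
move=> [s y] [s' y'] /allpairsP[[s1 y1] /= [sa _ [-> ->]]] /allpairsP[[s2 y2]
  /= [sa' _ [-> ->]]] /= /eqP.
rewrite eqseq_cat; first by case/andP=> /eqP -> /eqP ->.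
by rewrite (image_len comp sa) (image_len comp sa').
Qed.

Definition num_images theta a : R := #|` images theta a|%:R.

Lemma num_images_ge1 theta a : 1 <= num_images theta a.
Proof. by rewrite ler1n cardfs_gt0 images_neq0. Qed.

Lemma num_images_gt0 theta a : 0 < num_images theta a.
Proof. exact: lt_le_trans (num_images_ge1 theta a). Qed.

Lemma ln_num_images_ge0 theta a : 0 <= ln (num_images theta a).
Proof. exact: ln_ge0 (num_images_ge1 theta a). Qed.

Lemma size_word_outcomes theta u : (size (outcomes (word_law theta u)))%:R =
  \prod_(a <- u) num_images theta a.
Proof.
elim: u => [|a u IH]; first by rewrite big_nil.
by rewrite outcomes_word_cons size_allpairs big_cons natrM IH.
Qed.

Lemma prod_num_images_gt0 theta u : 0 < \prod_(a <- u) num_images theta a.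
Proof. by apply: prodr_gt0 => a _; exact: num_images_gt0. Qed.

Lemma prod_num_imagesE theta u :
  \prod_(a <- u) num_images theta a =
  expR (\sum_(a <- u) ln (num_images theta a)).
Proof.
by rewrite expR_sum; apply: eq_bigr => a _; rewrite lnK // posrE num_images_gt0.
Qed.

Lemma ln_prod_num_images theta u :
  ln (\prod_(a <- u) num_images theta a) =
  \sum_(a <- u) ln (num_images theta a).
Proof. by rewrite prod_num_imagesE expRK. Qed.

Section Rate.
Context (theta : random_subst R d) (comp : compatible theta) (fu : full theta).

Lemma ln_num_images_power_ge k a :
  \sum_b (cnt theta b a)%:R * ln (num_images (power theta k) b) <=
  ln (num_images (power theta k.+1) a).
Proof.
have /fset0Pn[s sa] := images_neq0 theta a.
under eq_bigr do rewrite mulr_natl.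
rewrite -(sum_image comp _ sa) -ln_prod_num_images ler_ln ?posrE
  ?prod_num_images_gt0 ?num_images_gt0 //.
rewrite -size_word_outcomes ler_nat; apply: uniq_leq_size.
  exact/uniq_word_outcomes/power_compatible.
move=> w /image_of_power sw; apply/in_power_images; rewrite -add1n.
by apply/iter_image_add; exists s => //; apply/iter_image1/image_of1.
Qed.

Lemma ln_num_images_power_le k a :
  ln (num_images (power theta k.+1) a) <=
  \sum_b (cnt theta b a)%:R * ln (num_images (power theta k) b) +
  ln (num_images theta a).
Proof.
set S := \sum_b _.
pose F := flatten [seq outcomes (word_law (power theta k) s) |
  s <- images theta a].
have FE : (size F)%:R = num_images theta a * expR S.
  rewrite /F size_flatten /shape -map_comp sumnE big_map natr_sum.
  transitivity (\sum_(s <- images theta a) expR S); last first.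
    by rewrite big_const_seq count_predT iter_addr_0 -(mulr_natl (expR S)).
  rewrite !big_seq; apply: eq_bigr => s sa /=.
  rewrite size_word_outcomes prod_num_imagesE (sum_image comp _ sa).
  by under eq_bigr do rewrite -mulr_natl.
rewrite -(expRK S) addrC -lnM ?posrE ?expR_gt0 ?num_images_gt0 // -FE.
rewrite ler_ln ?posrE ?num_images_gt0 //;
  last by rewrite FE mulr_gt0 ?expR_gt0 ?num_images_gt0.
rewrite ler_nat; apply: uniq_leq_size => // w /in_power_images.
rewrite -add1n => /iter_image_add[s /iter_image1/image_of1 sa sw].
apply/flattenP; exists (outcomes (word_law (power theta k) s));
  first exact: map_f.
exact/image_of_power.
Qed.

(** By the two preceding lemmas the relative growth rates at time [k.+1] are
    averages, with weights [share], of those at time [k], up to a bounded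
    number divided by the length. *)
Lemma growth_rate : exists h : R, forall a,
  (fun k => ln (num_images (power theta k) a) / (len theta k a)%:R) @ \oo --> h.
Proof.
have [delta d0 dP] := share_ge comp fu.
pose C : R := \sum_a ln (num_images theta a).
have C0 : 0 <= C by apply: sumr_ge0 => a _; exact: ln_num_images_ge0.
have lC a : ln (num_images theta a) <= C.
  by rewrite /C (bigD1 a) //= lerDl; apply: sumr_ge0 => b _;
    exact: ln_num_images_ge0.
pose q k a := ln (num_images (power theta k) a) / (len theta k a)%:R.
suff [h [hP _]] : exists h, (forall a, q ^~ a @ \oo --> h) /\
    (forall k x, (forall a, x <= q k a) -> x <= h) by exists h.
apply: (@averaging_cvg R _ ord0 _ (share theta) delta C) => // [|k a].
  exact: share_sum1.
have E : \sum_b share theta k b a * q k b =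
    (\sum_b (cnt theta b a)%:R * ln (num_images (power theta k) b)) / (len
      theta k.+1 a)%:R.
  rewrite mulr_suml; apply: eq_bigr => b _; rewrite /share /q natrM.
  by field; rewrite !gt_eqF // lenR_gt0.
rewrite E; apply/andP; split.
  by rewrite ler_pM2r ?invr_gt0 ?lenR_gt0 // ln_num_images_power_ge.
rewrite -lerBlDl -mulrBl; apply: le_trans (len1_le comp fu k a C0).
rewrite ler_pM2r ?invr_gt0 ?lenR_gt0 // lerBlDl.
apply: le_trans (ln_num_images_power_le k a) _; rewrite lerD2l.
apply: le_trans (lC a) _; rewrite ler_peMl // ler1n; exact: len_gt0.
Qed.

End Rate.
End Counting.

(** * Lower bound on the block entropies of a frequency *)

Section EntropyGrowth.
Context {R : realType} {d : nat} (eta : random_subst R d).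
Context (comp : compatible eta) (fu : full eta).
Context (unif : forall a s, s \in images eta a ->
  weight eta a s = (num_images eta a)^-1).
Context (m : word d -> R) (mF : is_frequency eta m) (im : invariant_weight m).
Context (mpos : forall v, language eta v -> 0 < m v).
Context (h : R) (hP : forall a, h * (len eta 1 a)%:R <= ln (num_images eta a)).
Implicit Types (a b : letter d) (u v w : word d) (k N : nat).

Lemma word_law_uniform u x : x \in word_law eta u ->
  x.1 = (\prod_(a <- u) num_images eta a)^-1.
Proof.
elim: u x => [|a u IH] x; first by rewrite inE => /eqP ->;
  rewrite big_nil invr1.
case/allpairsP=> -[y z] /= [/mapP[s sa ->] /IH zE ->] /=.
by rewrite zE unif // big_cons invfM.
Qed.

(** Given the [k]-th image of [a], the next one is uniformly distributed on a
    set whose cardinality does not depend on that image. *)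
Lemma mean_ln_markov_ge N k a : h * (len eta k.+1 a)%:R <=
  Ex (iter_law eta k.+1 [:: a]) (fun w => - ln (markov_weight m N w)).
Proof.
rewrite Ex_iterS -[leLHS](Ex_iter_cst eta k [:: a]).
apply: le_Ex; first exact: positive_iter.
move=> w aw; apply: (@le_trans _ _ (ln (\prod_(b <- w) num_images eta b))).
  rewrite ln_prod_num_images.
  have [z wz] := image_of_ex eta w.
  have az : iter_image eta k.+1 [:: a] z by apply/iter_imageS; exists w.
  rewrite -(iter_image_len1 comp az) (iter_image_len comp (proj2 (iter_image1
    eta w z) wz)).
  by rewrite natr_sum mulr_sumr; apply: ler_sum => b _; exact: hP.
apply: gibbs_uniform.
- exact: prod_num_images_gt0.
- exact: word_law_uniform.
- exact: Ex_word_one.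
- move=> z wz; apply: markov_weight_gt0 => // v vz; apply: mpos.
  by apply/languageP; exists a, k.+1, z; split=> //; apply/iter_imageS;
    exists w.
- apply: le_trans (sum_markov_weight N im (len eta k.+1 a)).
  apply: sum_uniq_le; first exact: uniq_word_outcomes.
    by move=> z wz; apply: (iter_image_len1 comp); apply/iter_imageS; exists w.
  exact: markov_weight_ge0.
Qed.

(** The mean of [- ln] of the Markov weight is computed from the numbers of
    occurrences of the words of length [N.+1]. Divided by the length of the
    images it tends to the increment of the block entropies, and it is at least
    [h] by [mean_ln_markov_ge]. *)
Lemma block_entropy_growth N : block_entropy m N + h <= block_entropy m N.+1.
Proof.
rewrite -lerBrDl block_entropyS //.
pose F k := \sum_(v : N.+1.-tuple (letter d))
  (mean_occ eta v k.+1 ord0 / (len eta k.+1 ord0)%:R) * - ln (cond_weight m v).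
have cF : F @ \oo --> \sum_(v : N.+1.-tuple (letter d)) m v * - ln (cond_weight
  m v).
  apply: cvg_fsum => v; apply: cvgM; last exact: cvg_cst.
  have := @mF v ord0; rewrite -cvg_shiftS; exact.
(* the second term accounts for the windows cut by the end of the word *)
pose G k := F k + (N%:R * ln d.+1%:R) / 2 ^+ k.
have cG : G @ \oo --> \sum_(v : N.+1.-tuple (letter d)) m v * - ln (cond_weight
  m v).
  rewrite -[X in _ --> X]addr0; apply: cvgD => //; exact: cvg_expV2.
apply: (cvgr_to_ge cG); apply: nearW => k.
have l0 := lenR_gt0 (R := R) comp k.+1 ord0.
rewrite -(ler_pM2r l0); apply: le_trans (mean_ln_markov_ge N k ord0) _.
set L := iter_law eta k.+1 [:: ord0].
apply: (@le_trans _ _ (Ex L (fun w => \sum_(v : N.+1.-tuple (letter d))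
    (occ v w)%:R * - ln (cond_weight m v) + N%:R * ln (d.+1)%:R))).
  apply: le_Ex; first exact: positive_iter.
  move=> w aw; apply: ln_markov_weight => // v vw; apply: mpos.
  by apply/languageP; exists ord0, k.+1, w.
rewrite ExD Ex_sum Ex_iter_cst /G mulrDl lerD //.
  rewrite /F mulr_suml; apply: ler_sum => v _.
  rewrite mulrAC divfK ?gt_eqF // [leRHS]mulrC -ExZ le_eqVlt; apply/orP; left.
  by apply/eqP/eq_Ex => w _; rewrite mulrC.
rewrite mulrAC ler_pdivlMr ?exprn_gt0 // ler_wpM2l //.
  by rewrite mulr_ge0 // ln_ge0 // ler1n.
rewrite -natrX ler_nat; apply: leq_trans (len_ge_exp comp fu k.+1 ord0).
by rewrite leq_exp2l.
Qed.

Lemma block_entropy_ge N : N%:R * h <= block_entropy m N.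
Proof.
elim: N => [|N IH].
  by rewrite mul0r /block_entropy (sum_tuple0 (fun v =>
    - (m v * ln (m v)))) iw_nil // ln1 mulr0 oppr0.
apply: le_trans (block_entropy_growth N).
by rewrite -natr1 mulrDl mul1r lerD2r.
Qed.

End EntropyGrowth.

(** * Upper bound on the complexity *)

Section Cover.
Context {R : realType} {d : nat} (eta : random_subst R d).
Context (comp : compatible eta) (C : nat).
Context (len_le : forall b, (len eta 1 b <= C)%N).
Implicit Types (a b : letter d) (u v w y z s : word d) (n N : nat).

(** Remove the letters of [w] whose images start after position [n] of [z]; the
    last image that is kept exceeds position [n] by at most [C]. *)
Lemma prefix_cover w z n : image_of eta w z -> exists w' z',
  [/\ image_of eta w' z', take n z = take n z' & (size z' <= n + C)%N].
Proof.
elim: w z n => [|a w IH] z n.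
  by move=> /image_of_nil ->; exists [::], [::]; split=> //; apply/image_of_nil.
case/image_of_cons=> s [y [sa wy ->]].
have [ns|sn] := leqP n (size s).
  exists [:: a], s; split; first exact/image_of1.
    by rewrite takel_cat.
  by rewrite (image_len comp sa) (leq_trans (len_le a)) // leq_addl.
have [w' [z' [wz yz szz]]] := IH y (n - size s)%N wy.
exists (a :: w'), (s ++ z'); split.
- by apply/image_of_cons; exists s, z'.
- by rewrite !take_cat !ltnNge ltnW //= yz.
- by rewrite size_cat -(subnKC (ltnW sn)) -addnA leq_add2l.
Qed.

(** A subword of an image of a word is, up to an offset of at most [C], the
    beginning of the image of a word that is not longer than needed. *)
Lemma infix_cover w z i n : image_of eta w z -> exists w' z' i',
  [/\ image_of eta w' z', (i' <= C)%N, take n (drop i z) = take n (drop i' z')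
    & (size z' <= n + C.*2)%N].
Proof.
elim: w z i => [|a w IH] z i.
  by move=> /image_of_nil ->; exists [::], [::], 0%N; split=> //;
    apply/image_of_nil.
move=> wz; have /image_of_cons[s [y [sa wy zE]]] := wz.
have [si|si] := leqP (size s) i.
  by rewrite zE drop_cat ltnNge si; exact: IH.
have iC : (i <= C)%N by rewrite (leq_trans (ltnW si)) // (image_len comp sa).
have [w' [z' [wz' zz szz]]] := prefix_cover (n + i) wz.
exists w', z', i; split=> //; last by lia.
by rewrite !take_drop zz.
Qed.

Fixpoint words_upto n : seq (word d) :=
  if n is k.+1 then
    [::] :: [seq a :: w | a <- enum (letter d), w <- words_upto k]
  else [:: [::]].

Lemma mem_words_upto n w : (size w <= n)%N -> w \in words_upto n.
Proof.
elim: n w => [|n IH] [|a w] //= wn; rewrite inE /=.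
by apply: allpairs_f; [rewrite mem_enum | exact: IH].
Qed.

(** The bound counts the words of length [n] over an alphabet with one more
    letter, which may serve to pad the shorter words. *)
Lemma size_words_upto n : (size (words_upto n) <= d.+2 ^ n)%N.
Proof.
elim: n => [//|n IH] /=; rewrite size_allpairs -cardE card_ord expnS.
have : (0 < d.+2 ^ n)%N by rewrite expn_gt0.
by move: IH; move: (size _) (d.+2 ^ n)%N => x y; nia.
Qed.

Context (c : nat) (c_gt0 : (0 < c)%N) (len_ge : forall b, (c <= len eta 1 b)%N).
Context (H : R) (H_ge0 : 0 <= H).
Context (ln_num_images_le : forall b,
  ln (num_images eta b) <= H * (len eta 1 b)%:R).

Definition word_cover N : seq (word d) :=
  flatten [seq flatten [seq [seq take N (drop i z) | i <- iota 0 C.+1]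
                       | z <- outcomes (word_law eta w)]
          | w <- [seq w <- words_upto ((N + C.*2) %/ c) |
                    (\sum_(b <- w) len eta 1 b <= N + C.*2)%N]].

Lemma language_cover v : language eta v -> v \in word_cover (size v).
Proof.
case/languageP=> a [k [w [k0 aw vw]]]; case: k k0 aw => // k _ aw.
have /iter_imageS[u _ uw] := aw; have /infixP[p [q wE]] := vw.
have [w' [z' [i [wz iC vE sz]]]] := infix_cover (size p) (size v) uw.
have vE' : v = take (size v) (drop i z').
  by rewrite -vE wE drop_size_cat // take_size_cat.
have lE := iter_image_len comp (proj2 (iter_image1 eta w' z') wz).
apply/flattenP; exists (flatten [seq [seq take (size v) (drop i z) | i <- iota
  0 C.+1]
                       | z <- outcomes (word_law eta w')]).
  apply: map_f; rewrite mem_filter -lE sz /=; apply: mem_words_upto.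
  rewrite leq_divRL //; apply: leq_trans sz; rewrite lE.
  rewrite -sum1_size big_distrl /=; apply: leq_sum => b _.
  by rewrite mul1n len_ge.
apply/flattenP; exists [seq take (size v) (drop i z') | i <- iota 0 C.+1].
  by apply: (map_f (fun z => [seq take (size v) (drop i z) | i <- iota 0
    C.+1])).
by rewrite {1}vE'; apply: (map_f (fun i => take (size v) (drop i z')));
  rewrite mem_iota.
Qed.

Lemma size_word_cover N : (size (word_cover N))%:R <=
  C.+1%:R * (d.+2%:R ^+ ((N + C.*2) %/ c) * expR (H * (N + C.*2)%:R)).
Proof.
rewrite /word_cover size_flatten /shape -map_comp sumnE big_map natr_sum.
set ws := [seq w <- _ | _].
apply: (@le_trans _ _ (\sum_(w <- ws) (C.+1%:R * expR (H * (N + C.*2)%:R)))).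
  rewrite !big_seq; apply: ler_sum => w; rewrite mem_filter => /andP[wl _] /=.
  rewrite size_flatten /shape -map_comp sumnE big_map.
  rewrite (eq_bigr (fun=> C.+1)); last by move=> z _ /=;
    rewrite size_map size_iota.
  rewrite big_const_seq count_predT iter_addn_0 natrM size_word_outcomes.
  rewrite ler_wpM2l // prod_num_imagesE ler_expR.
  apply: (@le_trans _ _ (\sum_(b <- w) H * (len eta 1 b)%:R)).
    by apply: ler_sum => b _.
  by rewrite -mulr_sumr -natr_sum ler_wpM2l // ler_nat.
rewrite big_const_seq count_predT iter_addr_0 -(mulr_natl (_ * _)) mulrCA
  ler_wpM2l //.
rewrite ler_wpM2r ?expR_ge0 // -natrX ler_nat.
by apply: leq_trans (size_words_upto _); rewrite size_filter count_size.
Qed.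

Lemma ln_complexity_le N : ln (#|lang_n (subshift eta) N|%:R : R) <=
  ln C.+1%:R + ((N + C.*2) %/ c)%:R * ln d.+2%:R + H * (N + C.*2)%:R.
Proof.
have le : (#|lang_n (subshift eta) N| <= size (word_cover N))%N.
  rewrite cardE -(size_map val); apply: uniq_leq_size.
    by rewrite map_inj_uniq ?enum_uniq //; exact: val_inj.
  move=> v /mapP[u]; rewrite mem_enum inE => /asboolP[x [i [xX xu]]] ->.
  rewrite -[N in word_cover N](size_tuple u); apply: language_cover.
  by have := xX i N; rewrite xu.
have [E|n0] := posnP #|lang_n (subshift eta) N|.
  rewrite E ln0 // addr_ge0 // ?mulr_ge0 // addr_ge0 ?mulr_ge0 // ln_ge0 //
    ler1n //.
rewrite -(ler_nat R) in le.
have C0 : 0 < C.+1%:R :> R by [].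
have D0 : 0 < d.+2%:R ^+ ((N + C.*2) %/ c) :> R by rewrite exprn_gt0.
apply: (@le_trans _ _ (ln (C.+1%:R * (d.+2%:R ^+ ((N + C.*2) %/ c) *
                           expR (H * (N + C.*2)%:R))))).
  rewrite ler_ln ?posrE ?ltr0n //; last by rewrite !mulr_gt0 ?expR_gt0.
  exact: le_trans le (size_word_cover N).
rewrite !lnM ?posrE ?mulr_gt0 ?expR_gt0 // expRK lnXn //.
by rewrite -(mulr_natl (ln _)) addrA.
Qed.

End Cover.

Section ComplexityRate.
Context {R : realType} {d : nat} (theta : random_subst R d).
Context (comp : compatible theta) (fu : full theta).

(** Choose [k] so large that the growth rates of the [k]-th images are at most
    [h + e / 4] and that the number of words of length [N / 2 ^ k] contributes
    at most [e / 4]; the remaining terms do not depend on [N]. *)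
Lemma complexity_rate (h e : R) : 0 < e ->
  (forall a, (fun k => ln (num_images (power theta k) a) / (len theta k a)%:R)
     @ \oo --> h) ->
  \forall N \near \oo,
    N%:R^-1 * ln (#|lang_n (subshift theta) N|%:R : R) <= h + e.
Proof.
move=> e0 hP.
have h0 : 0 <= h.
  apply: (cvgr_to_ge (hP ord0)); apply: nearW => k.
  by rewrite divr_ge0 // ln_num_images_ge0.
have e4 : 0 < e / 4 by rewrite divr_gt0.
have [k [k0 kq kd]] : exists k, [/\ (0 < k)%N,
    forall a, ln (num_images (power theta k) a) / (len theta k a)%:R <=
      h + e / 4
    & ln d.+2%:R / 2 ^+ k <= e / 4 :> R].
  near \oo => k; exists k; split.
  - by near: k; exists 1%N.
  - near: k; apply: filter_forall => a.
    have := hP a => /cvgrPdist_le /(_ _ e4); apply: filterS => k.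
    by rewrite ler_norml => /andP[+ _]; lra.
  - near: k; have := @cvg_expV2 R (ln d.+2%:R) => /cvgrPdist_le /(_ _ e4).
    by apply: filterS => k; rewrite ler_norml sub0r => /andP[+ _]; lra.
pose eta := power theta k.
have ceta : compatible eta by exact: power_compatible.
have lE b : len eta 1 b = len theta k b.
  have [w bw] := iter_image_ex theta k [:: b].
  rewrite -(iter_image_len1 comp bw) -(@image_len _ _ _ ceta b w) //.
  exact/in_power_images.
pose C := (\sum_b len eta 1 b)%N.
have lC b : (len eta 1 b <= C)%N by rewrite /C (bigD1 b) //= leq_addr.
have lc b : (2 ^ k <= len eta 1 b)%N by rewrite lE len_ge_exp.
have lH b : ln (num_images eta b) <= (h + e / 4) * (len eta 1 b)%:R.
  by rewrite -ler_pdivrMr lE ?lenR_gt0.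
have c0 : (0 < 2 ^ k)%N by rewrite expn_gt0.
have H0 : 0 <= h + e / 4 by lra.
rewrite -(subshift_power (full_spreads fu) k0) -/eta.
pose K : R := ln C.+1%:R + (e / 4 + (h + e / 4)) * C.*2%:R.
near=> N.
have N0 : 0 < N%:R :> R by rewrite ltr0n; near: N; exists 1%N.
rewrite mulrC ler_pdivrMr //.
apply: le_trans (ln_complexity_le ceta lC c0 lc H0 lH N) _.
have h1 : ((N + C.*2) %/ (2 ^ k))%:R * ln d.+2%:R <= e / 4 * (N + C.*2)%:R :> R.
  apply: (@le_trans _ _ (((N + C.*2) %/ (2 ^ k))%:R * ((2 ^ k)%:R * (e / 4)))).
    by rewrite ler_wpM2l // natrX mulrC -ler_pdivrMr // exprn_gt0.
  rewrite mulrA -natrM [leLHS]mulrC ler_wpM2l ?(ltW e4) // ler_nat.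
  exact: leq_trunc_div.
have h2 : K <= e / 4 * N%:R.
  rewrite -ler_pdivrMl //; near: N; exact: nbhs_infty_ger.
have h3 : 0 <= e / 4 * N%:R by rewrite mulr_ge0 // ltW.
by move: h1 h2 h3; rewrite /K natrD; lra.
Unshelve. all: by end_near. Qed.

End ComplexityRate.

(** * Coding by nested intervals *)

Section Coding.
Context {R : realType} (T : finType) (x0 : T) (p : seq T -> R).
Context (p_ge0 : forall s, 0 <= p s) (p_nil : p [::] = 1).
Context (p_rcons : forall s, \sum_a p (rcons s a) = p s).
Implicit Types (s : seq T) (a b : T) (t : R) (n : nat).

(** The left end of the interval of the child of rank [n], relative to the
    interval of [s]. *)
Definition weight_below s n : R := \sum_(b | (enum_rank b < n)%N) p (rcons s b).

Lemma weight_below_rank s a :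
  weight_below s (enum_rank a).+1 =
  weight_below s (enum_rank a) + p (rcons s a).
Proof.
rewrite /weight_below (bigD1 a) //= addrC; congr (_ + _).
apply: eq_bigl => b; rewrite ltnS leq_eqVlt andb_orl.
rewrite (inj_eq val_inj) (inj_eq enum_rank_inj).
by case: eqVneq => [->|_] /=; rewrite ?ltnn ?andbT ?andbF.
Qed.

Lemma weight_below_le s n k : (n <= k)%N ->
  weight_below s n <= weight_below s k.
Proof.
move=> nk; rewrite /weight_below [leRHS](bigID (fun b => enum_rank b < n)%N) /=.
rewrite [X in _ <= X + _](eq_bigl (fun b => enum_rank b < n)%N).
  by rewrite lerDl sumr_ge0.
by move=> b; case: (ltnP (enum_rank b) n) => bn;
  rewrite ?andbT ?andbF ?(leq_trans bn nk).
Qed.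

Lemma weight_below_card s : weight_below s #|T| = p s.
Proof. by rewrite -p_rcons; apply: eq_bigl => b; rewrite ltn_ord. Qed.

Lemma weight_below0 s : weight_below s 0 = 0.
Proof. by rewrite /weight_below big_pred0. Qed.

(** The recursion is on the reversed word because children extend words at the
    end. *)
Fixpoint rev_low (r : seq T) : R :=
  if r is a :: r' then rev_low r' + weight_below (rev r') (enum_rank a) else 0.

(** Words index nested intervals: those of the children of [s] partition the
    interval of [s] into pieces whose lengths are their weights. *)
Definition low s := rev_low (rev s).
Definition cell s t := low s <= t < low s + p s.

Lemma low_rcons s a : low (rcons s a) = low s + weight_below s (enum_rank a).
Proof. by rewrite /low rev_rcons /= revK. Qed.

Lemma cell_rcons s a t : cell (rcons s a) t =
  (weight_below s (enum_rank a) <= t - low s < weight_below s (enum_rank a).+1).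
Proof.
by rewrite /cell low_rcons -addrA -weight_below_rank lerBrDl ltrBlDl.
Qed.

Lemma cell_rconsW s a t : cell (rcons s a) t -> cell s t.
Proof.
rewrite cell_rcons /cell => /andP[h1 h2].
have := weight_below_le s (leq0n (enum_rank a)).
have := @weight_below_le s (enum_rank a).+1 #|T| (ltn_ord _).
by rewrite weight_below0 weight_below_card => h3 h4; apply/andP; split; lra.
Qed.

Lemma cell_inj s a b t : cell (rcons s a) t -> cell (rcons s b) t -> a = b.
Proof.
rewrite !cell_rcons => /andP[h1 h2] /andP[h3 h4].
apply/enum_rank_inj/val_inj => /=.
have [ab|ba|//] := ltngtP (enum_rank a) (enum_rank b).
  by exfalso; have := weight_below_le s ab; lra.
by exfalso; have := weight_below_le s ba; lra.
Qed.

Lemma cell_ex s t : cell s t -> exists a, cell (rcons s a) t.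
Proof.
move=> /andP[st ts].
have E : exists n, t - low s < weight_below s n.
  by exists #|T|; rewrite weight_below_card ltrBlDl.
case: (ex_minnP E) => -[|n] tn nmin.
  by move: tn; rewrite weight_below0; lra.
have nT : (n < #|T|)%N.
  by apply: nmin; rewrite weight_below_card ltrBlDl.
exists (enum_val (Ordinal nT)); rewrite cell_rcons enum_valK tn andbT leNgt.
by apply/negP => /nmin; rewrite /= ltnn.
Qed.

Fixpoint code t n : seq T :=
  if n is k.+1 then
    rcons (code t k) (odflt x0 [pick a | cell (rcons (code t k) a) t])
  else [::].

Lemma code_cell t n : cell [::] t -> cell (code t n) t.
Proof.
move=> t01; elim: n => //= n IH; case: pickP => [//|none].
by have [a] := cell_ex IH; rewrite none.
Qed.

Lemma codeP t s : cell [::] t -> code t (size s) = s <-> cell s t.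
Proof.
move=> t01; split=> [<-|]; first exact: code_cell.
elim/last_ind: s => // s a IH st.
have E := IH (cell_rconsW st).
have := code_cell (size s).+1 t01.
rewrite size_rcons /= E => h; congr rcons.
exact: cell_inj h st.
Qed.

(** Points outside the unit interval get the code of 0, which makes the coding
    total without changing its law under the uniform measure. *)
Definition coding t n : T := last x0 (code (if cell [::] t then t else 0) n.+1).

Lemma mkseq_coding t n : mkseq (coding t) n =
  code (if cell [::] t then t else 0) n.
Proof. by elim: n => //= n IH; rewrite mkseqS IH /coding /= last_rcons. Qed.

Definition unit_prob : probability (measurableTypeR R) R :=
  uniform_prob (@ltr01 R).
Notation P := unit_prob.

Lemma cellE s : [set t | cell s t] = `[low s, low s + p s[%classic.
Proof. by apply/seteqP; split=> t /=; rewrite in_itv. Qed.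

Lemma cell_low s : 0 <= low s /\ low s + p s <= 1.
Proof.
elim/last_ind: s => [|s a [h1 h2]]; first by rewrite p_nil /low /= add0r.
rewrite low_rcons -addrA -weight_below_rank.
have := weight_below_le s (leq0n (enum_rank a)).
have := @weight_below_le s (enum_rank a).+1 #|T| (ltn_ord _).
by rewrite weight_below0 weight_below_card => h3 h4; split; lra.
Qed.

Lemma uniform_prob_itv (x y : R) : 0 <= x -> x <= y -> y <= 1 ->
  P `[x, y[%classic = (y - x)%:E.
Proof.
move=> x0' xy y1.
transitivity (\int[lebesgue_measure]_(t in `[x, y[)
  (uniform_pdf 0 1 t)%:E)%E => //.
rewrite integral_uniform_pdf.
rewrite setIidl; last by move=> t /=; rewrite !in_itv /= => /andP[h1 h2];
  apply/andP; split; lra.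
rewrite (eq_integral (fun=> 1%E)); last first.
  move=> t; rewrite inE /= in_itv /= => /andP[h1 h2]; rewrite /uniform_pdf.
  by rewrite subr0 invr1 ifT //; apply/andP; split; lra.
rewrite integral_cst //= mul1e lebesgue_measure_itv /= lte_fin.
by case: ltP => // yx; congr EFin; lra.
Qed.

(** Up to points outside the unit interval, the points whose code starts with
    [s] are those of the cell of [s], an interval of length [p s]. *)
Lemma coding_cylinder s :
  measurable [set t | mkseq (coding t) (size s) = s] /\
  P [set t | mkseq (coding t) (size s) = s] = (p s)%:E.
Proof.
set E := [set t | _].
have uE t : cell [::] t -> E t <-> cell s t.
  by move=> t01; rewrite /E /= mkseq_coding t01; exact: codeP.
have m01 : measurable [set t | cell [::] t] by rewrite cellE.
have P01 : P (~` [set t | cell [::] t]) = 0%E.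
  have -> : P (~` [set t | cell [::] t]) = (1 - P [set t | cell [::] t])%E.
    exact: probability_setC.
  rewrite cellE uniform_prob_itv ?p_nil /low //= ?add0r //.
  by rewrite subr0 subee.
(* all points outside of the unit interval, a null set, have the same code *)
pose B : set R := if code 0 (size s) == s then ~` [set t | cell [::] t] else
  set0.
have mB : measurable B by rewrite /B; case: ifP => _ //; exact: measurableC.
have ms : measurable [set t | cell s t] by rewrite cellE.
have -> : E = [set t | cell s t] `|` B.
  apply/seteqP; split=> t.
    case: (boolP (cell [::] t)) => t01; first by move/(uE t t01); left.
    rewrite /E /= mkseq_coding (negbTE t01) => /eqP sE; right.
    by rewrite /B sE /=; exact/negP.
  have sub : cell s t -> cell [::] t.
    by elim/last_ind: (s) => // s' a IH /cell_rconsW.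
  case=> [st|]; first exact/(uE t (sub st)).
  rewrite /B; case: eqP => // sE /= /negP/negbTE t01.
  by rewrite /E /= mkseq_coding t01.
split; first exact: measurableU.
rewrite measureU0 //; last first.
  by rewrite /B; case: ifP => _; rewrite ?measure0.
have [h1 h2] := cell_low s; have := p_ge0 s => h3.
have hs : low s <= low s + p s by lra.
rewrite cellE; apply: (etrans (uniform_prob_itv h1 hs h2)).
by congr EFin; lra.
Qed.

End Coding.

(** * Cylinders of the full shift *)

Section Cylinders.
Context {d : nat}.
Implicit Types (x y : fullshift d) (v w : word d) (i j : int) (n k : nat).
Implicit Types (a b : letter d).

Definition block i v : set (fullshift d) := [set x | subword x i (size v) = v].

Lemma subword_cons x i n : subword x i n.+1 = x i :: subword x (i + 1) n.
Proof.
rewrite /subword /mkseq /= addr0 -[1%N]addn0 iotaDl -map_comp; congr cons.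
by apply: eq_map => k /=; rewrite -addrA.
Qed.

Lemma subword_rcons x i n :
  subword x i n.+1 = rcons (subword x i n) (x (i + n%:Z)).
Proof. exact: mkseqS. Qed.

Lemma size_subword x i n : size (subword x i n) = n.
Proof. exact: size_mkseq. Qed.

Lemma subword_shift x i n : subword (Defs.shift x) i n = subword x (i + 1) n.
Proof. by apply: eq_map => k; rewrite /Defs.shift addrAC. Qed.

Lemma open_coord i a : open ([set x | x i = a] : set (fullshift d)).
Proof.
have : continuous (fun x : fullshift d => x i : discrete_topology (letter d)).
  exact: (@proj_continuous int (fun=> discrete_topology (letter d)) i).
by move=> /continuousP/(_ [set a] (discrete_open _)).
Qed.

Lemma open_block i v : open (block i v).
Proof.
elim: v i => [|a v IH] i.
  by rewrite (_ : block i [::] = setT); [exact: openT | apply/seteqP].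
rewrite (_ : block i (a :: v) = [set x | x i = a] `&` block (i + 1) v).
  by apply: openI; [exact: open_coord | exact: IH].
apply/seteqP; split=> x; rewrite /block /= subword_cons => -[-> ->] //.
Qed.

Lemma measurable_block i v : measurable (block i v).
Proof. by apply: sub_sigma_algebra; exact: open_block. Qed.

(** The coordinates from [- n] to [n - 1], so that a window is extended by one
    letter on each side. *)
Definition window n x : word d := subword x (- n%:Z) n.*2.

Lemma nth_window n x k : (k < n.*2)%N -> nth ord0 (window n x) k =
  x (k%:Z - n%:Z).
Proof. by move=> kn; rewrite nth_mkseq // addrC. Qed.

Lemma window_coord n x y : window n x = window n y <->
  forall i, - n%:Z <= i < n%:Z -> x i = y i.
Proof.
split=> [xy i /andP[h1 h2]|xy].
  have kn : (absz (i + n%:Z)%R < n.*2)%N by lia.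
  have := nth_window x kn; rewrite xy nth_window //.
  by have -> : (absz (i + n%:Z))%:Z - n%:Z = i by lia.
apply: (@eq_from_nth _ ord0); rewrite !size_subword // => k kn.
by rewrite !nth_window //; apply: xy; lia.
Qed.

Lemma window_le n k x y : (n <= k)%N -> window k x = window k y ->
  window n x = window n y.
Proof.
move=> nk /window_coord h; apply/window_coord => i hi; apply: h; lia.
Qed.

Lemma size_window n x : size (window n x) = n.*2.
Proof. exact: size_subword. Qed.

(** The sets that contain all points with the window of [x] of some radius form
    a filter, which converges to [x] since it does so in each coordinate. *)
Lemma nbhs_window x (U : set (fullshift d)) : nbhs x U ->
  exists n, forall y, window n y = window n x -> U y.
Proof.
pose F : set_system (fullshift d) :=
  filter_from setT (fun n => [set y | window n y = window n x]).
have FF : Filter F.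
  apply: filter_from_filter; first by exists 0%N.
  move=> n k _ _; exists (maxn n k) => // y /= yx.
  by split; apply: window_le yx; rewrite ?leq_maxl ?leq_maxr.
suff : F --> x by move=> /[apply] -[n _ nU]; exists n => y /nU.
apply/cvg_sup => i.
have surj : [set f i | f in @setT (fullshift d)] = setT.
  by apply/seteqP; split=> // a _; exists (fun=> a).
apply/cvg_image => //.
apply/(@discrete_cvg (discrete_topology (letter d))); first exact: filter_image.
exists [set y | y i = x i]; last first.
  by apply/seteqP; split=> [a [y <- ->]//|a ->]; exists x.
exists (absz i).+1 => // y /= /window_coord; apply; lia.
Qed.

Lemma nbhs_of_window n x : nbhs x [set y | window n y = window n x].
Proof.
apply: open_nbhs_nbhs; split=> //.
have := open_block (- n%:Z) (window n x).
by rewrite /block size_window.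
Qed.

Definition window_sets : set (set (fullshift d)) :=
  [set A | A = set0 \/ exists n v, A = [set x | window n x = v]].

Lemma measurable_window n v :
  measurable ([set x | window n x = v] : set (fullshift d)).
Proof.
have [sv|sv] := eqVneq (size v) n.*2.
  by have := measurable_block (- n%:Z) v; rewrite /block sv.
rewrite (_ : [set x | _] = set0) //; apply/seteqP; split=> // x /= xv.
by rewrite -xv size_window eqxx in sv.
Qed.

(** There are only countably many windows. *)
Lemma measurable_window_sets : @measurable _ (fullshift d) = <<s window_sets >>.
Proof.
apply/seteqP; split; last first.
  apply: smallest_sub; first exact: sigma_algebra_measurable.
  by move=> _ [->//|[n [v ->]]]; exact: measurable_window.
apply: smallest_sub; first exact: smallest_sigma_algebra.
move=> U oU.
pose V (p : nat * word d) : set (fullshift d) :=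
  if `[< [set x | window p.1 x = p.2] `<=` U >]
  then [set x | window p.1 x = p.2] else set0.
have -> : U = \bigcup_p V p.
  apply/seteqP; split=> x.
    move=> Ux; have [n nU] := nbhs_window (open_nbhs_nbhs (conj oU Ux)).
    exists (n, window n x) => //; rewrite /V /= asboolT //.
  by case=> p _; rewrite /V; case: ifPn => // /asboolP; exact.
apply: (@countable_bigcupT_measurable _ (g_sigma_algebraType window_sets)) =>
  // p.
rewrite /V; case: ifP => _; apply: sub_sigma_algebra; last by left.
by right; exists p.1, p.2.
Qed.

(** Of two windows, one prolongs the other or they exclude each other. *)
Lemma window_setsI : setI_closed window_sets.
Proof.
have H n k v w : (n <= k)%N -> window_sets
    ([set x | window n x = v] `&` [set x | window k x = w]).
  move=> nk; have [[x [xv xw]]|nx] :=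
    pselect (exists x, window n x = v /\ window k x = w).
    right; exists k, w; apply/seteqP; split=> y /=; first by case.
    by move=> yw; split=> //; rewrite -xv; apply: (window_le nk); rewrite yw xw.
  by left; apply/seteqP; split=> // x [xv xw]; apply: nx; exists x.
move=> A B [->|[n [v ->]]]; first by rewrite set0I; left.
move=> [->|[k [w ->]]]; first by rewrite setI0; left.
by have [nk|/ltnW kn] := leqP n k; [exact: H | rewrite setIC; exact: H].
Qed.

Lemma shift_window n x v : window n (Defs.shift x) = v <->
  subword x (1 - n%:Z) n.*2 = v.
Proof. by rewrite /window subword_shift addrC. Qed.

Lemma measurable_shift : measurable_fun setT (@Defs.shift d).
Proof.
apply: (measurability window_sets measurable_window_sets).
move=> _ [_ [->|[n [v ->]]] <-]; rewrite setTI ?preimage_set0 //.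
rewrite (_ : _ @^-1` _ = [set x | subword x (1 - n%:Z) n.*2 = v]); last first.
  by apply/seteqP; split=> x h; [exact/shift_window | exact: (proj2
    (shift_window n x v))].
have [sv|sv] := eqVneq (size v) n.*2.
  by have := measurable_block (1 - n%:Z) v; rewrite /block sv.
rewrite (_ : [set x | _] = set0) //; apply/seteqP; split=> // x /= xv.
by rewrite -xv size_subword eqxx in sv.
Qed.

End Cylinders.

(** * The measure of an invariant weight *)

Section MeasureOfWeight.
Context {R : realType} {d : nat}.
Implicit Types (m : word d -> R) (mu : probability (fullshift d) R).
Implicit Types (v w : word d) (i : int) (n k : nat) (a b : letter d).
Implicit Types (s : seq (letter d * letter d)).

(** A point of the full shift is coded by the pairs of its coordinates [-n-1]
    and [n]. *)
Definition two_sided (x : nat -> letter d * letter d) : fullshift d :=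
  fun i => match i with Posz k => (x k).2 | Negz k => (x k).1 end.

Definition unfold_pairs s : word d :=
  rev [seq q.1 | q <- s] ++ [seq q.2 | q <- s].

Lemma unfold_pairs_rcons s q :
  unfold_pairs (rcons s q) = q.1 :: rcons (unfold_pairs s) q.2.
Proof. by rewrite /unfold_pairs !map_rcons rev_rcons /= rcons_cat. Qed.

Lemma unfold_pairs_inj s s' : size s = size s' ->
  unfold_pairs s = unfold_pairs s' -> s = s'.
Proof.
move=> ss /eqP; rewrite /unfold_pairs eqseq_cat ?size_rev ?size_map //.
move=> /andP[/eqP /(can_inj revK) E1 /eqP E2].
by rewrite -(zip_unzip s) -(zip_unzip s') /unzip1 /unzip2 E1 E2.
Qed.

Lemma windowS n (x : fullshift d) :
  window n.+1 x = x (- (n.+1)%:Z) :: rcons (window n x) (x n%:Z).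
Proof.
rewrite /window doubleS subword_cons subword_rcons;
  congr (_ :: rcons (subword _ _ _) (x _)); lia.
Qed.

Lemma window_two_sided n x : window n (two_sided x) = unfold_pairs (mkseq x n).
Proof.
elim: n => [//|n IH].
by rewrite windowS IH mkseqS unfold_pairs_rcons.
Qed.

(** Pairs of letters extend a window by one letter on each side, and invariance
    makes the weights of these extensions add up to the weight of the window.
    The measure is the law of the coding of the unit interval by pairs. *)
Lemma weight_measure_exists m : invariant_weight m ->
  exists mu : probability (fullshift d) R,
    forall n v, size v = n.*2 -> mu [set x | window n x = v] = (m v)%:E.
Proof.
move=> im; pose p s := m (unfold_pairs s).
have p0 s : 0 <= p s by exact: iw_ge0.
have pnil : p [::] = 1 by exact: iw_nil.
have prc s : \sum_q p (rcons s q) = p s.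
  rewrite /p; under eq_bigr do rewrite unfold_pairs_rcons.
  rewrite -(pair_bigA _ (fun a b => m (a :: rcons (unfold_pairs s) b))) /=.
  rewrite exchange_big /=; under eq_bigr do rewrite iw_cons //.
  exact: iw_rcons.
pose f (t : measurableTypeR R) : fullshift d := two_sided (coding (ord0,
  ord0) p t).
have fE n s : size s = n -> f @^-1` [set x | window n x = unfold_pairs s] =
    [set t | mkseq (coding (ord0, ord0) p t) (size s) = s].
  move=> sn; apply/seteqP; split=> t /=; rewrite window_two_sided sn.
    by apply: unfold_pairs_inj; rewrite size_mkseq.
  by move=> ->.
have pairs n v : size v = n.*2 -> exists2 s, size s = n & unfold_pairs s = v.
  move=> vn.
  have st : size (take n v) = n by rewrite size_takel // vn -addnn leq_addr.
  have sd : size (drop n v) = n by rewrite size_drop vn -addnn addnK.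
  exists (zip (rev (take n v)) (drop n v)).
    by rewrite size_zip size_rev st sd minnn.
  rewrite /unfold_pairs -/(unzip1 _) -/(unzip2 _).
  by rewrite unzip1_zip ?unzip2_zip ?size_rev ?st ?sd // revK cat_take_drop.
have mf : measurable_fun setT f.
  apply: (measurability window_sets measurable_window_sets).
  move=> _ [_ [->|[n [v ->]]] <-]; rewrite setTI ?preimage_set0 //.
  have [sv|sv] := eqVneq (size v) n.*2.
    have [s sn <-] := pairs n v sv; rewrite fE //.
    by have [] := coding_cylinder (ord0, ord0) p0 pnil prc s.
  rewrite (_ : _ @^-1` _ = set0) //; apply/seteqP; split=> // t /= tv.
  by rewrite -tv size_window eqxx in sv.
pose X : {mfun measurableTypeR R >-> fullshift d} :=
  HB.pack f (isMeasurableFun.Build _ _ _ _ f mf).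
exists (distribution unit_prob X) => n v /pairs[s sn <-].
rewrite /distribution /pushforward /= fE //.
by have [] := coding_cylinder (ord0, ord0) p0 pnil prc s.
Qed.

Lemma measure_letters mu (A : set (fullshift d)) i :
  measurable A ->
  mu A = (\sum_(a < d.+1) mu (A `&` [set x : fullshift d | x i = a]))%E.
Proof.
move=> mA; rewrite -measure_bigsetU_ord.
- congr (mu _); rewrite -bigcup_seq; apply/seteqP; split=> x.
    by move=> Ax; exists (x i) => //=; rewrite mem_index_enum.
  by case=> a _ [].
- move=> a; apply: measurableI => //; apply: sub_sigma_algebra;
  exact: open_coord.
- by move=> a b _ _ [x [[_ <-] [_ <-]]].
Qed.

(** The weights of the blocks of a given length and position determine those of
    all blocks inside this range, by summing over one letter at either end. *)
Lemma block_weight m mu : invariant_weight m ->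
  (forall n v, size v = n.*2 -> mu [set x | window n x = v] = (m v)%:E) ->
  forall i v, mu (block i v) = (m v)%:E.
Proof.
move=> im mw.
pose C i k := forall v, size v = k -> mu (block i v) = (m v)%:E.
have Cr i k : C i k.+1 -> C i k.
  move=> H v vk; rewrite (measure_letters mu (i + k%:Z) (measurable_block i v)).
  rewrite -(iw_rcons im) -sumEFin; apply: eq_bigr => a _.
  rewrite -H ?size_rcons ?vk //; congr (mu _); apply/seteqP; split=> x /=.
    by rewrite /block /= size_rcons vk subword_rcons => -[-> ->].
  by rewrite /block /= size_rcons vk subword_rcons => /rcons_inj[-> ->].
have Cl i k : C i k.+1 -> C (i + 1) k.
  move=> H v vk; rewrite (measure_letters mu i (measurable_block (i + 1) v)).
  rewrite -(iw_cons im) -sumEFin; apply: eq_bigr => a _.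
  rewrite -H /= ?vk //; congr (mu _); apply/seteqP; split=> x /=.
    by rewrite /block /= vk subword_cons => -[-> ->].
  by rewrite /block /= vk subword_cons => -[-> ->].
have Cln (n : nat) i k : C i (k + n)%N -> C (i + n%:Z) k.
  elim: n i k => [|n IH] i k; first by rewrite addn0 addr0.
  rewrite addnS => /Cl /IH; rewrite -addrA.
  by have -> : 1 + n%:Z = n.+1%:Z by lia.
have Crn (n : nat) i k : C i (k + n)%N -> C i k.
  by elim: n => [|n IH]; [rewrite addn0 | rewrite addnS => /Cr].
move=> i v; pose n := (absz i + size v)%N.
have Cn : C (- n%:Z) n.*2.
  by move=> w wn; rewrite -(mw n w wn) /block wn.
suff : C i (size v) by apply.
have -> : i = - n%:Z + (absz (i + n%:Z)%R)%:Z by rewrite /n; lia.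
apply: Cln.
apply: (Crn (n.*2 - (size v + absz (i + n%:Z)%R))%N).
by rewrite subnKC // /n; lia.
Qed.

(** The measure and its image under the shift agree on the windows, which are
    stable under intersection and generate the Borel sets. *)
Lemma block_invariant m mu : (forall i v, mu (block i v) = (m v)%:E) ->
  forall B, measurable B -> mu (@Defs.shift d @^-1` B) = mu B.
Proof.
move=> mb B mB.
pose X : {mfun fullshift d >-> fullshift d} :=
  HB.pack (@Defs.shift d) (isMeasurableFun.Build _ _ _ _ _ (@measurable_shift
    d)).
apply: (@measure_unique _ R (fullshift d) window_sets (fun=> setT)
  measurable_window_sets window_setsI _ _ (distribution mu X) mu _ _ B mB).
- move=> _; right; exists 0%N, [::]; apply/seteqP; split=> //.
- by apply/seteqP; split=> // x _; exists 0%N.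
- move=> _ [->|[n [v ->]]]; first by rewrite !measure0.
  rewrite /distribution /pushforward /=.
  have [sv|sv] := eqVneq (size v) n.*2.
    transitivity (mu (block (1 - n%:Z) v)).
      congr (mu _); apply/seteqP; split=> x; rewrite /block sv => h.
        exact/shift_window.
      exact: (proj2 (shift_window n x v)).
    have -> : [set x | window n x = v] = block (- n%:Z) v by rewrite /block sv.
    by rewrite !mb.
  have e : [set x | window n x = v] = set0.
    by apply/seteqP; split=> // x /= xv; rewrite -xv size_window eqxx in sv.
  by rewrite e !measure0.
- move=> _; apply: le_lt_trans (ltry 1); exact: (@probability_le1 _ _ _
  (distribution mu X)).
Qed.

(** A subshift with its language [L] as parameter; [subshift theta] unfolds to
    [points_of (language theta)]. *)
Definition points_of (L : set (word d)) : set (fullshift d) :=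
  [set x | forall i n, L (subword x i n)].

Lemma points_ofC L : ~` points_of L =
  \bigcup_(q : int * word d) (if `[< L q.2 >] then set0 else block q.1 q.2).
Proof.
apply/seteqP; split=> x.
  move=> /existsNP[i /existsNP[n nL]]; exists (i, subword x i n) => //=.
  by rewrite asboolF // /block /= size_subword.
case=> -[i v] _ /=; case: asboolP => // nL xv H.
by apply: nL; rewrite -xv.
Qed.

Lemma measurable_points L : measurable (points_of L).
Proof.
rewrite -[points_of L]setCK; apply: measurableC; rewrite points_ofC.
apply: countable_bigcupT_measurable => // -[i v] /=.
by case: ifP => // _; exact: measurable_block.
Qed.

(** The complement is a countable union of blocks of weight 0. *)
Lemma measure_points L m mu : (forall i v, mu (block i v) = (m v)%:E) ->
  (forall v, ~ L v -> m v = 0) -> mu (points_of L) = 1%E.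
Proof.
move=> mb mL.
suff E : mu (~` points_of L) = 0%E.
  have := probability_setC mu (measurableC (measurable_points L)).
  by rewrite setCK E sube0.
pose F n : set (fullshift d) :=
  if @choice.unpickle (int * word d)%type n is Some q then
    (if `[< L q.2 >] then set0 else block q.1 q.2) else set0.
have -> : ~` points_of L = \bigcup_n F n.
  rewrite points_ofC; apply/seteqP; split=> x [q _ qx].
    by exists (choice.pickle q) => //; rewrite /F choice.pickleK.
  by move: qx; rewrite /F; case: choice.unpickle => // q' q'x; exists q'.
have mF n : measurable (F n).
  by rewrite /F; case: choice.unpickle => // q; case: ifP => // _;
    exact: measurable_block.
apply/negligibleP; first exact: bigcup_measurable.
apply: negligible_bigcup => n; apply/negligibleP; first exact: mF.
rewrite /F; case: choice.unpickle => [q|]; last exact: measure0.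
by case: asboolP => [_|/mL q0]; [exact: measure0 | exact: etrans (mb _ _)
  (congr1 EFin q0)].
Qed.

Lemma measure_points_block L m mu i v :
  (forall i w, mu (block i w) = (m w)%:E) ->
  (forall w, ~ L w -> m w = 0) -> mu (points_of L `&` block i v) = (m v)%:E.
Proof.
move=> mb mL; rewrite -(mb i).
have mP := measurable_points L; have mB := measurable_block i v.
apply/esym; rewrite -{1}(setTI (block i v)) -(setUv (points_of L)) setIUl.
rewrite measureU0 //; [exact: measurableI | by apply: measurableI => //;
  exact: measurableC | ].
apply/eqP; rewrite eq_le measure_ge0 andbT.
have -> : 0%E = mu (~` points_of L).
  by rewrite probability_setC // (measure_points mb mL) subee.
have mC : measurable (~` points_of L) by exact: measurableC.
apply: le_measure; [rewrite inE; exact: measurableI |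
  by rewrite inE | exact: subIsetl].
Qed.

Lemma measure_cylinder L m mu v : (forall i w, mu (block i w) = (m w)%:E) ->
  (forall w, ~ L w -> m w = 0) -> mu (cylinder (points_of L) v) = (m v)%:E.
Proof. exact: measure_points_block. Qed.

End MeasureOfWeight.

(** * Weak convergence from convergence on cylinders *)

Section WeakConvergence.
Context {R : realType} {d : nat} (L : set (word d)).
Implicit Types (m : word d -> R) (mu : probability (fullshift d) R).
Implicit Types (v w : word d) (n : nat) (f : fullshift d -> R).

Notation X := (points_of L).

Lemma compact_letters : compact [set: discrete_topology (letter d)].
Proof.
apply: finite_compact; exact: finite_finset.
Qed.

Lemma compact_fullshift : compact [set: fullshift d].
Proof.
have := @tychonoff int (fun=> discrete_topology (letter d)) (fun=> setT)
  (fun=> compact_letters).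
by rewrite (_ : [set f | _] = setT) //; apply/seteqP.
Qed.

Lemma closed_points : closed X.
Proof.
rewrite -[X]setCK; apply: open_closedC; rewrite points_ofC.
apply: bigcup_open => -[i v] _ /=.
by case: ifP => _; [exact: open0 | exact: open_block].
Qed.

Lemma compact_points : compact X.
Proof.
apply: subclosed_compact; [exact: closed_points | exact: compact_fullshift |
  by []].
Qed.

(** By compactness the continuity of [f] is uniform, and windows describe the
    neighbourhoods of all points. *)
Lemma continuous_window f (e : R) : {within X, continuous f} -> 0 < e ->
  exists n, forall x y, X x -> X y -> window n x = window n y ->
    `|f x - f y| <= e.
Proof.
move=> cf e0.
pose P n x := forall y, X y -> window n y = window n x -> `|f x - f y| <= e.
have /near_covering_withinP/(_ nat \oo P _) : near_covering X.
  exact/compact_near_coveringP/compact_points.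
case.
  move=> x Xx.
  have e2 : 0 < e / 2 by rewrite divr_gt0.
  have : nbhs (x : subspace X) [set y | `|f x - f y| < e / 2].
    by have /cvgrPdist_lt/(_ _ e2) := cf x.
  rewrite -[nbhs _]/(nbhs_subspace _) -(nbhs_subspace_in Xx) =>
    /nbhs_window[n0 nP].
  exists ([set y | window n0 y = window n0 x], [set n | (n0 <= n)%N]).
    by split; [exact: nbhs_of_window | exists n0].
  move=> [x' n] /= [x'x n0n] Xx' y Xy yx'.
  have h1 := nP x' x'x Xx'.
  have h2 : `|f x - f y| < e / 2.
    by apply: (nP y _ Xy); rewrite (window_le n0n yx').
  rewrite [leRHS]splitr (le_trans (ler_distD (f x) _ _)) // lerD //.
    by rewrite distrC ltW.
  exact: ltW.
move=> n _ /(_ n (leqnn n)) H; exists n => x y Xx Xy xy.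
by apply: (H x Xx y Xy).
Qed.

Lemma measurable_continuous f : {within X, continuous f} -> measurable_fun X f.
Proof.
move=> /continuousP cf.
apply: (measurability _ (RGenOpens.measurableE R)).
move=> _ [_ [a [b ->] <-]].
have /open_subspaceP[V oV VX] : open (f @^-1` `]a, b[ : set (subspace X)).
  exact/cf/interval_open.
rewrite setIC -VX; apply: measurableI; last exact: measurable_points.
by apply: sub_sigma_algebra.
Qed.

Lemma integral_close mu (A : set (fullshift d)) f (c e a : R) : measurable A ->
  measurable_fun A f -> (forall x, A x -> `|f x - c| <= e) -> mu A = a%:E ->
  exists2 r, (\int[mu]_(x in A) (f x)%:E)%E = r%:E & `|r - c * a| <= e * a.
Proof.
move=> mA mf fc Aa.
have Afin : (mu A < +oo)%E by rewrite Aa ltry.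
have bd (g : fullshift d -> R) (M : R) : measurable_fun A g ->
    (forall x, A x -> `|g x| <= M) -> mu.-integrable A (EFin \o g).
  move=> mg gM; apply: measurable_bounded_integrable => //.
  exists M; split; first exact: num_real.
  by move=> N MN x Ax; apply: le_trans (gM x Ax) (ltW MN).
have fi : mu.-integrable A (EFin \o f).
  apply: (bd f (`|c| + e) mf) => x Ax.
  by have := fc x Ax; have := ler_normD (f x - c) c; rewrite subrK; lra.
have ci (k : R) : mu.-integrable A (EFin \o cst k).
  by apply: (bd _ `|k|) => // x _.
have := integrable_fin_num mA fi.
case E : (\int[mu]_(x in A) (EFin \o f) x)%E => [r| |] // _.
exists r => //.
have h1 : (\int[mu]_(x in A) (EFin \o f) x <= \int[mu]_(x in A) (EFin \o cst (c
  + e)%R) x)%E.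
  apply: le_integral => // x; rewrite inE => Ax /=.
  by rewrite lee_fin; have := fc x Ax; rewrite ler_norml => /andP[]; lra.
have h2 : (\int[mu]_(x in A) (EFin \o cst (c - e)%R) x <= \int[mu]_(x in A)
  (EFin \o f) x)%E.
  apply: le_integral => // x; rewrite inE => Ax /=.
  by rewrite lee_fin; have := fc x Ax; rewrite ler_norml => /andP[]; lra.
move: h1 h2; rewrite E /= !integral_cst // => h1 h2.
have {}h1 : r <= (c + e) * a by rewrite -lee_fin EFinM -Aa.
have {}h2 : (c - e) * a <= r by rewrite -lee_fin EFinM -Aa.
by rewrite ler_norml; apply/andP; split; lra.
Qed.

(** [f] is within [e] of a function of a window. What matters is that [n] and
    [c] do not depend on the measure, which only enters through its weights. *)
Lemma integral_window f (e : R) : {within X, continuous f} -> 0 < e ->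
  exists n (c : n.-tuple (letter d) -> R), forall m mu, invariant_weight m ->
    (forall i v, mu (block i v) = (m v)%:E) ->
    (forall v, ~ L v -> m v = 0) ->
    exists2 r, (\int[mu]_(x in X) (f x)%:E)%E = r%:E &
      `|r - \sum_(w : n.-tuple (letter d)) c w * m w| <= e.
Proof.
move=> cf e0; have [n nP] := continuous_window cf e0.
pose W (w : n.*2.-tuple (letter d)) : set (fullshift d) :=
  X `&` [set x | window n x = w].
have /choice[c cP] : forall w : n.*2.-tuple (letter d), exists c : R,
  forall x, W w x -> `|f x - c| <= e.
  move=> w; have [[x [Xx xw]]|no] := pselect (exists x, W w x); last first.
    by exists 0 => x xW; case: no; exists x.
  exists (f x) => y [Xy yw]; apply: nP => //.
  exact: etrans yw (esym xw).
exists n.*2, c => m mu im mb mL.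
have mW (w : n.*2.-tuple (letter d)) : measurable (W w).
  by apply: measurableI; [exact: measurable_points | exact: measurable_window].
have muW (w : n.*2.-tuple (letter d)) : mu (W w) = (m w)%:E.
  rewrite -(measure_points_block (- n%:Z) w mb mL) /block size_tuple.
  by [].
have XW : X = \big[setU/set0]_(w <- index_enum _) W w.
  rewrite -bigcup_seq; apply/seteqP; split=> x.
    move=> Xx; have sw : size (window n x) == n.*2 by rewrite size_window.
    by exists (Tuple sw) => //=; rewrite mem_index_enum.
  by case=> w _ [].
have mf := measurable_continuous cf.
have /choice[r rP] : forall w : n.*2.-tuple (letter d), exists r,
    (\int[mu]_(x in W w) (f x)%:E)%E = r%:E /\ `|r - c w * m w| <= e * m w.
  move=> w; have [r r1 r2] := integral_close (mW w)
    (measurable_funS (measurable_points L) (@subIsetl _ _ _) mf) (cP w) (muW w).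
  by exists r.
exists (\sum_w r w).
  rewrite [in LHS]XW integral_bigsetU_EFin //.
  - by rewrite -sumEFin; apply: eq_bigr => w _; case: (rP w).
  - exact: index_enum_uniq.
  - by move=> w w' _ _ [x [[_ xw] [_ xw']]]; apply: val_inj;
    rewrite /= -xw -xw'.
  - by rewrite -XW; exact/measurable_EFinP.
rewrite -sumrB; apply: le_trans (ler_norm_sum _ _ _) _.
apply: (@le_trans _ _ (\sum_w e * m (tval w))).
  by apply: ler_sum => w _; case: (rP w).
by rewrite -mulr_sumr sum_weight // mulr1.
Qed.

Lemma weak_cvg (m_ : nat -> word d -> R) m
    (mu_ : nat -> probability (fullshift d) R) mu :
  (forall k, invariant_weight (m_ k)) -> invariant_weight m ->
  (forall k i v, mu_ k (block i v) = (m_ k v)%:E) ->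
  (forall i v, mu (block i v) = (m v)%:E) ->
  (forall k v, ~ L v -> m_ k v = 0) -> (forall v, ~ L v -> m v = 0) ->
  (forall v, m_ ^~ v @ \oo --> m v) ->
  weakly_converges X mu_ mu.
Proof.
move=> im_ im mb_ mb mL_ mL mm f cf.
have fin (m' : word d -> R) (nu : probability (fullshift d) R) :
    invariant_weight m' -> (forall i v, nu (block i v) = (m' v)%:E) ->
    (forall v, ~ L v -> m' v = 0) -> exists r, (\int[nu]_(x in X) (f x)%:E)%E =
      r%:E.
  have [n [c cP]] := integral_window cf ltr01.
  by move=> im' mb' mL'; have [r -> _] := cP m' nu im' mb' mL'; exists r.
have /choice[r_ r_P] : forall k, exists r, (\int[mu_ k]_(x in X) (f x)%:E)%E =
  r%:E.
  by move=> k; exact: (fin (m_ k) (mu_ k) (im_ k) (mb_ k) (mL_ k)).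
have [r rP] := fin m mu im mb mL.
rewrite rP; under eq_fun do rewrite r_P.
apply/cvg_EFin; first by apply: nearW.
apply/cvgrPdist_le => e e0.
have e3 : 0 < e / 3 by rewrite divr_gt0.
have [n [c cP]] := integral_window cf e3.
have cS : (fun k => \sum_(w : n.-tuple (letter d)) c w * m_ k w) @ \oo -->
    \sum_(w : n.-tuple (letter d)) c w * m w.
  by apply: cvg_fsum => w; apply: cvgM; [exact: cvg_cst | exact: mm].
have /cvgrPdist_le/(_ _ e3) := cS; apply: filterS => k kS.
have [r1 r1E r1P] := cP m mu im mb mL.
have [r2 r2E r2P] := cP (m_ k) (mu_ k) (im_ k) (mb_ k) (mL_ k).
have rr1 : r = r1 by move: r1E; rewrite rP => -[].
have rr2 : r_ k = r2 by move: r2E; rewrite r_P => -[].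
rewrite /= rr1 rr2; move: r1P r2P kS; rewrite !ler_norml.
by move=> /andP[h1 h2] /andP[h3 h4] /andP[h5 h6]; apply/andP; split; lra.
Qed.

End WeakConvergence.

(** * Limits of weights *)

Section Limits.
Context {R : realType} {d : nat}.
Implicit Types (m : word d -> R) (v w : word d) (n N : nat).

(** By Tychonoff's theorem the sequence has a cluster point; since there are
    countably many words, a subsequence converges to it. *)
Lemma diagonal_subsequence (m_ : nat -> word d -> R) :
  (forall n v, 0 <= m_ n v <= 1) ->
  exists (s : nat -> nat) m,
    (forall n, (n <= s n)%N) /\ forall v, (fun n => m_ (s n) v) @ \oo --> m v.
Proof.
move=> m01.
pose W : countType := word d.
have K := @tychonoff (word d) (fun=> R) (fun=> `[0, 1]%classic)
  (fun=> @segment_compact R 0 1).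
pose T := prod_topology (fun _ : word d => R : topologicalType).
pose F : set_system T := (m_ : nat -> T) @ \oo.
have [m [_ mF]] : [set f : T | forall v, `[0, 1]%classic (f v)] `&` cluster F
  !=set0.
  by apply: K; exists 0%N => // n _ v /=; rewrite in_itv /= m01.
have near_m v e : 0 < e -> nbhs (m : T) [set f : T | `|m v - f v| < e].
  move=> e0; have c := @proj_continuous (word d) (fun=> R : topologicalType) v
    m.
  have := c (ball (m v) e); apply.
  exact: nbhsx_ballx.
pose G j i : set T := [set f | if @choice.unpickle W i is Some w
  then `|m w - f w| < j.+1%:R^-1 else True].
have near_G j k : nbhs (m : T) [set f | forall i, (i < k)%N -> G j i f].
  elim: k => [|k IH]; first by apply: filterS (filterT : nbhs (m : T) setT).
  have Gk : nbhs (m : T) (G j k).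
    case E : (@choice.unpickle W k) => [w|]; last first.
      have -> : G j k = setT by rewrite /G E; apply/seteqP.
      exact: filterT.
    have -> : G j k = [set f : T | `|m w - f w| < j.+1%:R^-1] by rewrite /G E.
    by apply: near_m; rewrite invr_gt0.
  apply: filterS (filterI IH Gk) => f [fk fG] i.
  by rewrite ltnS leq_eqVlt => /predU1P[-> //|]; exact: fk.
have /choice[s sP] : forall j, exists n, (j <= n)%N /\
    forall w, (@choice.pickle W w < j)%N -> `|m w - m_ n w| < j.+1%:R^-1.
  move=> j.
  have FA : F [set f : T | exists2 n, (j <= n)%N & f = m_ n].
    by exists j => // n jn; exists n.
  have [_ [[n jn ->] nP]] := mF _ _ FA (near_G j j).
  by exists n; split=> // w /nP; rewrite /G /mkset choice.pickleK.
exists s, m; split=> [n|v]; first by case: (sP n).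
apply/cvgrPdist_lt => e e0.
have : (@harmonic R) @ \oo --> (0 : R) by exact: cvg_harmonic.
move=> /cvgrPdist_lt/(_ _ e0) hN.
near=> j.
apply: lt_trans (proj2 (sP j) v _) _.
  by near: j; exists (@choice.pickle W v).+1.
have : `|0 - harmonic j| < e by near: j.
by rewrite sub0r normrN /harmonic /= ger0_norm // invr_ge0.
Unshelve. all: by end_near. Qed.

(** Write [- ln x] as [2 * ln t] with [t] the inverse of the square root of
    [x], and use [ln t <= t - 1]. *)
Lemma sqrt_xlnx_bound (x : R) : 0 <= x <= 1 ->
  0 <= - (x * ln x) <= 2 * Num.sqrt x.
Proof.
rewrite le_eqVlt => /andP[/orP[/eqP <-|x0] x1].
  by rewrite mul0r oppr0 sqrtr0 mulr0 lexx.
have s0 : 0 < Num.sqrt x by rewrite sqrtr_gt0.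
rewrite -mulrN; apply/andP; split.
  by rewrite mulr_ge0 ?(ltW x0) // oppr_ge0 ln_le0.
have xE : x = Num.sqrt x * Num.sqrt x by rewrite -expr2 sqr_sqrtr ?(ltW x0).
have h : - ln (Num.sqrt x) <= (Num.sqrt x)^-1 - 1.
  rewrite -lnV ?posrE //; apply: ln_le_subr1; by rewrite invr_gt0.
have -> : - ln x = 2 * - ln (Num.sqrt x).
  by rewrite {1}xE lnM ?posrE //; lra.
have h2 : x * (2 * - ln (Num.sqrt x)) <= x * (2 * (Num.sqrt x)^-1).
  by rewrite ler_wpM2l ?(ltW x0) //; lra.
apply: le_trans h2 _; rewrite {1}xE.
by rewrite [2 * _^-1]mulrC mulrA -(mulrA (Num.sqrt x)) divff ?gt_eqF // mulr1
  mulrC.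
Qed.

Lemma cvg_xlnx (u : nat -> R) (l : R) : (forall n, 0 <= u n <= 1) ->
  u @ \oo --> l -> (fun n => - (u n * ln (u n))) @ \oo --> - (l * ln l).
Proof.
move=> u01 ul.
have l0 : 0 <= l by apply: (cvgr_to_ge ul); apply: nearW => n;
  case/andP: (u01 n).
move: l0; rewrite le_eqVlt => /orP[/eqP l0|l0]; last first.
  apply: cvgN; apply: cvgM => //.
  exact: (cvg_comp u (@ln R) ul (continuous_ln l0)).
rewrite -l0 mul0r oppr0.
apply: (@squeeze_cvgr _ _ _ _ (fun=> 0) (fun n => 2 * Num.sqrt (u n))).
- by apply: nearW => n; exact: sqrt_xlnx_bound.
- exact: cvg_cst.
- have c : (fun n => 2 * Num.sqrt (u n)) @ \oo --> 2 * Num.sqrt l.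
    apply: cvgM; first exact: cvg_cst.
    exact: (cvg_comp u (@Num.sqrt R) ul (@sqrt_continuous R l)).
  by rewrite -l0 sqrtr0 mulr0 in c.
Qed.

Lemma cvg_block_entropy (m_ : nat -> word d -> R) m N :
  (forall n, invariant_weight (m_ n)) -> (forall v, m_ ^~ v @ \oo --> m v) ->
  (fun n => block_entropy (m_ n) N) @ \oo --> block_entropy m N.
Proof.
move=> im mm; apply: cvg_fsum => u; apply: cvg_xlnx; last exact: mm.
by move=> n; rewrite iw_ge0 // weight_le1.
Qed.

Lemma invariant_weight_cvg (m_ : nat -> word d -> R) m :
  (forall n, invariant_weight (m_ n)) -> (forall v, m_ ^~ v @ \oo --> m v) ->
  invariant_weight m.
Proof.
move=> im mm.
have uniq (f g : nat -> R) (l l' : R) : f @ \oo --> l -> g @ \oo --> l' ->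
    f =1 g -> l = l'.
  move=> fl gl /funext fg; rewrite fg in fl.
  exact: (@cvg_unique _ (@Rhausdorff R)) fl gl.
split=> [v||v|v].
- by apply: (cvgr_to_ge (mm v)); apply: nearW => n; exact: iw_ge0.
- apply: (uniq _ (fun=> 1) _ _ (mm [::])); first exact: cvg_cst.
  by move=> n; rewrite iw_nil.
- apply: (uniq _ _ _ _ (cvg_fsum (fun a => mm (rcons v a))) (mm v)) => n.
  exact: iw_rcons.
- apply: (uniq _ _ _ _ (cvg_fsum (fun a => mm (a :: v))) (mm v)) => n.
  exact: iw_cons.
Qed.

(** For [u] in [S], bound [- ln (#|S| * m u)] by [(#|S| * m u)^-1 - 1] and
    average with weights [m u]. *)
Lemma block_entropy_le m N (S : {set N.-tuple (letter d)}) :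
  invariant_weight m ->
  (forall u, u \notin S -> m (tval u) = 0) ->
  block_entropy m N <= ln (#|S|%:R : R).
Proof.
move=> im mS.
have sumS (F : word d -> R) : (forall u : N.-tuple (letter d), u \notin S ->
  F u = 0) ->
    \sum_(u : N.-tuple (letter d)) F u = \sum_(u in S) F u.
  by move=> F0; rewrite [RHS]big_mkcond; apply: eq_bigr => u _;
    case: ifPn => // /F0.
have m1 : \sum_(u in S) m (tval u) = 1 by rewrite -sumS ?sum_weight.
have S0 : 0 < #|S|%:R :> R.
  rewrite ltr0n card_gt0; apply/eqP => S00; move: m1; rewrite S00 big_set0.
  by move/eqP; rewrite eq_sym oner_eq0.
rewrite /block_entropy (sumS (fun u => - (m u * ln (m u)))); last first.
  by move=> u /mS ->; rewrite mul0r oppr0.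
have -> : ln (#|S|%:R : R) =
    \sum_(u in S) (m (tval u) * ln #|S|%:R + (#|S|%:R^-1 - m (tval u))).
  rewrite big_split /= -mulr_suml m1 mul1r sumrB m1 sumr_const.
  by rewrite -(mulr_natr (_^-1)) mulVf ?gt_eqF // subrr addr0.
apply: ler_sum => u _; have := iw_ge0 im u;
  rewrite le_eqVlt => /orP[/eqP <-|u0].
  by rewrite !mul0r oppr0 addr0 add0r invr_ge0 ltW.
have Su : 0 < #|S|%:R * m u by rewrite mulr_gt0.
have h : - ln (#|S|%:R * m u) <= (#|S|%:R * m u)^-1 - 1.
  by rewrite -lnV ?posrE //; apply: ln_le_subr1; rewrite invr_gt0.
rewrite lnM ?posrE // in h.
have := ler_wpM2l (ltW u0) h.
have -> : m u * ((#|S|%:R * m u)^-1 - 1) = #|S|%:R^-1 - m u.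
  by rewrite invfM mulrBr mulr1 mulrCA divff ?gt_eqF // mulr1.
lra.
Qed.

End Limits.

(** * Frequency measures of high powers and their limit *)

Section Assembly.
Context {R : realType} {d : nat}.

Lemma frequency_measure_of_weight (eta : random_subst R d) (m : word d -> R)
    (mu : probability (fullshift d) R) :
  compatible eta -> is_frequency eta m ->
  (forall v, ~ language eta v -> m v = 0) ->
  (forall i v, mu (block i v) = (m v)%:E) -> frequency_measure eta mu.
Proof.
move=> comp mF mL mb; split.
  by split; [exact: measure_points mb mL | exact: block_invariant mb].
move=> v _ a; rewrite -/(points_of _) (measure_cylinder v mb mL) /=.
by under eq_fun do rewrite mean_len //; exact: mF.
Qed.

Lemma entropyE (L : set (word d)) (m : word d -> R)
    (mu : probability (fullshift d) R) :
  (forall i v, mu (block i v) = (m v)%:E) -> (forall v, ~ L v -> m v = 0) ->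
  (forall N (u : N.-tuple (letter d)), u \notin lang_n (points_of L) N ->
    m (tval u) = 0) /\
  entropy (points_of L) mu = lim ((fun n => n%:R^-1 * block_entropy m n) @ \oo).
Proof.
move=> mb mL.
have muE v := measure_cylinder v mb mL.
have m0 N (u : N.-tuple (letter d)) : u \notin lang_n (points_of L) N ->
  m (tval u) = 0.
  rewrite inE => /asboolPn nu.
  have c0 : cylinder (points_of L) (tval u) = set0.
    apply/seteqP; split=> // x [Lx xu]; apply: nu; exists x, 0; split=> //.
    by rewrite -xu size_tuple.
  have := muE (tval u); rewrite c0 measure0 => -[] <- //.
split=> //; rewrite /entropy; congr (lim (_ @ \oo)); apply/funext => n.
congr (_ * _); rewrite /block_entropy big_mkcond /=; apply: eq_bigr => u _.
by case: ifPn => [_|/m0 ->]; rewrite ?muE ?mul0r ?oppr0.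
Qed.

Lemma squeeze_rate (a b : nat -> R) (h : R) :
  (\forall N \near \oo, h <= a N <= b N) ->
  (forall e, 0 < e -> \forall N \near \oo, b N <= h + e) ->
  a @ \oo --> h /\ b @ \oo --> h.
Proof.
move=> ab bh; split; apply/cvgrPdist_le => e e0; near=> N.
  have /andP[h1 h2] : h <= a N <= b N by near: N.
  have h3 : b N <= h + e by near: N; exact: bh.
  by rewrite ler_norml; apply/andP; split; lra.
have /andP[h1 h2] : h <= a N <= b N by near: N.
have h3 : b N <= h + e by near: N; exact: bh.
by rewrite ler_norml; apply/andP; split; lra.
Unshelve. all: by end_near. Qed.

End Assembly.

Section PowerFrequencies.
Context {R : realType} {d : nat} (theta : random_subst R d).
Context (comp : compatible theta) (fu : full theta).

Lemma len_power k a : len (power theta k) 1 a = len theta k a.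
Proof.
have [w aw] := iter_image_ex theta k [:: a].
rewrite -(iter_image_len1 comp aw) -(@image_len _ _ _
  (power_compatible (n := k) comp) a w) //.
exact/in_power_images.
Qed.

(** The growth rates of high powers are at least [h - e], and the bound of
    [block_entropy_ge] holds for all [N] at once. *)
Lemma power_block_entropy (m_ : nat -> word d -> R) (h e : R) :
  (forall a, (fun k => ln (num_images (power theta k) a) / (len theta k a)%:R)
     @ \oo --> h) ->
  (forall n, [/\ is_frequency (power theta n.+1) (m_ n), invariant_weight (m_ n)
    & forall v, language (power theta n.+1) v -> 0 < m_ n v]) ->
  0 < e -> \forall n \near \oo, forall N,
    N%:R * (h - e) <= block_entropy (m_ n) N.
Proof.
move=> hP mP e0.
have : \forall k \near \oo, forall a,
    h - e <= ln (num_images (power theta k) a) / (len theta k a)%:R.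
  apply: filter_forall => a; have /cvgrPdist_le/(_ _ e0) := hP a.
  by apply: filterS => k; rewrite ler_norml => /andP[]; lra.
case=> k0 _ k0P; exists k0 => // n /= k0n N.
have [mF im mpos] := mP n.
apply: (@block_entropy_ge _ _ (power theta n.+1)) => //.
- exact: power_compatible.
- exact: full_power.
- move=> a; rewrite len_power -ler_pdivlMr ?lenR_gt0 //.
  by apply: k0P; exact: leq_trans k0n (leqnSn n).
Qed.

End PowerFrequencies.

Theorem theorem4p2 (R : realType) (d : nat) (theta : random_subst R d)
    (theta_prim : primitive_subst theta) (theta_comp : compatible theta) :
  exists (mu_ : nat -> probability (fullshift d) R)
         (mu : probability (fullshift d) R),
    [/\ forall n, exists eta : random_subst R d,
          [/\ primitive_subst eta, subshift eta = subshift theta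
            & frequency_measure eta (mu_ n)],
        weakly_converges (subshift theta) mu_ mu
      & measure_of_maximal_entropy (subshift theta) mu].
Proof.
have [K K0 [sp fu]] := primitive_full theta_comp theta_prim.
rewrite -(subshift_power sp K0).
have comp := power_compatible (n := K) theta_comp.
have prim := primitive_power K0 theta_comp theta_prim.
move: (power theta K) fu comp prim => th fu comp prim.
pose eta n := power th n.+1.
have ceta n : compatible (eta n) by exact: power_compatible.
have feta n : full (eta n) by exact: full_power.
have Leta n : language (eta n) = language th by apply: (language_power
  (full_spreads fu)).
have [h hP] := growth_rate comp fu.
have /choice[f fP] := fun n => frequency_weight (ceta n) (feta n).
have f01 n v : 0 <= f n v <= 1.
  by have [_ im _ _] := fP n; rewrite iw_ge0 // weight_le1.
have [s [m [sn fm]]] := diagonal_subsequence f01.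
have fim n : invariant_weight (f (s n)) by have [] := fP (s n).
have im : invariant_weight m by exact: (invariant_weight_cvg fim fm).
have f0 n v : ~ language th v -> f (s n) v = 0.
  by have [_ _ _ H] := fP (s n); rewrite -(Leta (s n)); exact: H.
have m0 v : ~ language th v -> m v = 0.
  move=> vL; have := fm v; under eq_fun do rewrite f0 //.
  by move=> c; apply: (@cvg_unique _ (@Rhausdorff R)) c _; exact: cvg_cst.
have ex m' : invariant_weight m' -> exists mu : probability (fullshift d) R,
    forall i v, mu (block i v) = (m' v)%:E.
  move=> im'; have [mu muP] := weight_measure_exists im'.
  by exists mu; exact: block_weight im' muP.
have /choice[mu_ mu_P] := fun n => ex _ (fim n).
have [mu muP] := ex _ im.
exists mu_, mu; split.
- move=> n; exists (eta (s n)); split.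
  + exact: primitive_power.
  + exact: (subshift_power (full_spreads fu)).
  + have [fF _ _ _] := fP (s n); apply: (frequency_measure_of_weight _ fF _
    (mu_P n)).
      exact: ceta.
    by move=> v; rewrite Leta; exact: f0.
- exact: (weak_cvg fim im mu_P muP f0 m0 fm).
- have [mS eE] := entropyE muP m0.
  rewrite /measure_of_maximal_entropy -[subshift th]/(points_of (language th))
    eE.
  have lower N : N%:R * h <= block_entropy m N.
    have cb := cvg_block_entropy (N := N) fim fm.
    apply/ler_addgt0Pr => e e0.
    rewrite -lerBlDr; apply: (cvgr_to_ge cb).
    have e1 : 0 < e / N.+1%:R by rewrite divr_gt0.
    have fP' n : [/\ is_frequency (eta n) (f n), invariant_weight (f n) &
        forall v, language (eta n) v -> 0 < f n v] by have [] := fP n.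
    have [n0 _ n0P] := power_block_entropy comp fu hP fP' e1.
    exists n0 => // n /= n0n; apply: le_trans (n0P (s n) _ N).
      rewrite mulrBr lerD2l lerN2 mulrA ler_pdivrMr // mulrC ler_wpM2l ?ltW //.
      by rewrite ltr_nat.
    exact: leq_trans n0n (sn n).
  have [] := @squeeze_rate _ (fun N => N%:R^-1 * block_entropy m N)
    (fun N => N%:R^-1 * ln (#|lang_n (points_of (language th)) N|%:R : R)) h.
  + exists 1%N => // N /= N0; have Np : 0 < N%:R :> R by rewrite ltr0n.
    rewrite -(ler_pM2l Np) mulrA mulfV ?gt_eqF // mul1r lower /=.
    by rewrite ler_wpM2l ?invr_ge0 //; apply: block_entropy_le => // u;
      exact: mS.
  + by move=> e e0; exact: complexity_rate.
  move=> ca cb; split.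
    by split; [exact: measure_points muP m0 | exact: block_invariant muP].
  by rewrite /htop (cvg_lim _ ca) // (cvg_lim _ cb).
Qed.
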